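(* Let $n\in\mathbb{N}$, let $H$ be a Hilbert space, let $\delta>0$, and let $\phi:M_n\rightarrow B(H)$ be an injective completely positive contraction with $\Vert \phi^{-1}\Vert_{cb}<1+\delta$. Suppose there is a rank $1$ projection $p\in B(H)$ and an element $x\in M_n$ such that $\Vert \phi(x)-p\Vert <\delta$. Then there are (1) a rank $1$ projection $r\in M_n$ such that $\Vert \phi(r)-p\Vert\leq 315\,\delta^{1/8}$, and (2) a complete order embedding $\psi:M_n\rightarrow B(H)$ such that $\Vert \psi-\phi\Vert_{cb}\leq 1360\,\delta^{1/32}$.
   Context: $M_n$ is the $C^*$-algebra of complex $n\times n$ matrices and $B(H)$ the bounded operators on $H$. A linear map between $C^*$-algebras is a complete order embedding if it is completely positive and completely isometric (it need not be unital). For an injective linear map $\phi:A\to B$ with closed range, $\Vert\phi^{-1}\Vert_{cb}$ denotes the completely bounded norm of the inverse map $\phi^{-1}:\phi(A)\to A$. *)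

(* Defs.v *)
From HB Require Import structures.
From mathcomp Require Import all_boot all_order all_algebra complex.
From mathcomp Require Import all_classical all_reals all_analysis.

Set Implicit Arguments.
Unset Strict Implicit.
Unset Printing Implicit Defensive.

Import Order.TTheory GRing.Theory Num.Theory numFieldNormedType.Exports.

Local Open Scope classical_set_scope.
Local Open Scope ring_scope.

(* Inner products are linear in the first argument and conjugate-linear in   *)
(* the second. `|x| is R[i]-valued, hence the equation is stated in R[i].    *)
HB.mixin Record NormedModule_isHilbert (R : realType) H
    of CompleteNormedModule R[i] H := {
  hdot : {dot H for Num.conj};
  hdotE : forall x : H, `|x| ^+ 2 = hdot x x }.

#[short(type="hilbertType")]
HB.structure Definition Hilbert (R : realType) :=
  { H of CompleteNormedModule R[i] H & NormedModule_isHilbert R H }.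

Section StandardInnerProduct.
Variables (R : realType) (n : nat).
Implicit Types u v : 'cV[R[i]]_n.

Definition cdot u v : R[i] := \sum_(i < n) u i 0 * Num.conj (v i 0).

Lemma cdot_bilinear :
  bilinear_for (GRing.Scale.Law.clone _ _ *%R _)
               (GRing.Scale.Law.clone _ _ (Num.conj \; *%R) _) cdot.
Proof.
split=> [v a u1 u2|u a v1 v2] /=; rewrite /cdot mulr_sumr -big_split /=;
  apply: eq_bigr => i _; rewrite !mxE.
  by rewrite mulrDl mulrA.
by rewrite rmorphD rmorphM mulrDr mulrCA.
Qed.

HB.instance Definition _ :=
  bilinear_isBilinear.Build _ _ _ _ _ _ cdot cdot_bilinear.

Lemma cdotC u v : cdot u v = (-1) ^+ false * Num.conj (cdot v u).
Proof.
rewrite expr0 mul1r /cdot rmorph_sum; apply: eq_bigr => i _.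
by rewrite rmorphM /= conjCK mulrC.
Qed.

HB.instance Definition _ :=
  isHermitianSesquilinear.Build _ _ _ _ cdot cdotC.

Lemma cdot_gt0 u : u != 0 -> 0 < cdot u u.
Proof.
move=> u0; have [i ui0] : exists i, u i 0 != 0.
  apply/existsP; apply: contraNT u0; rewrite negb_exists => /forallP u0.
  by apply/eqP/colP => i; rewrite mxE; apply/eqP; rewrite -[_ == _]negbK u0.
rewrite /cdot (bigD1 i) //= ltr_wpDr ?mul_conjC_gt0 //.
by rewrite sumr_ge0 // => j _; rewrite mul_conjC_ge0.
Qed.

HB.instance Definition _ := isDotProduct.Build _ _ cdot cdot_gt0.

End StandardInnerProduct.

(* A linear space A faithfully represented by linear operators on an inner   *)
(* product space; M_k(A) is then normed and ordered by letting it act on the *)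
(* k-fold Hilbert sum of that space. Both M_n (acting on C^n) and B(H)       *)
(* (acting on H) are declared below as instances.                            *)
HB.mixin Record isOperatorSpace (R : realType) A of GRing.Lmodule R[i] A := {
  os_space : lmodType R[i];
  os_dot : {dot os_space for Num.conj};
  os_act : A -> os_space -> os_space;
  os_act_linear : forall a, linear (os_act a);
  os_linear_act : forall v, linear (os_act ^~ v);
  os_act_inj : injective os_act }.

#[short(type="operatorSpaceType")]
HB.structure Definition OperatorSpace (R : realType) :=
  { A of GRing.Lmodule R[i] A & isOperatorSpace R A }.

Arguments os_space {R} s.

Section MatrixOperatorSpace.
Variables (R : realType) (n : nat).

Definition mx_act (A : 'M[R[i]]_n) (v : 'cV[R[i]]_n) : 'cV[R[i]]_n := A *m v.

Lemma mx_act_linear A : linear (mx_act A).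
Proof. by move=> a u v; rewrite /mx_act mulmxDr scalemxAr. Qed.

Lemma mx_linear_act v : linear (mx_act ^~ v).
Proof. by move=> a A B; rewrite /mx_act mulmxDl scalemxAl. Qed.

Lemma mx_act_inj : injective mx_act.
Proof.
move=> A B AB; apply/trmx_inj/row_matrixP => i.
apply: trmx_inj; rewrite -!tr_col !trmxK !colE.
exact: (congr1 (fun f => f (delta_mx i 0)) AB).
Qed.

HB.instance Definition _ := isOperatorSpace.Build R 'M[R[i]]_n
  (@cdot R n : {dot 'cV[R[i]]_n for Num.conj}) mx_act_linear mx_linear_act mx_act_inj.

End MatrixOperatorSpace.

Section BoundedOperators.
Variables (R : realType) (H : hilbertType R).

Definition bounded_op : {pred H -> H} :=
  [pred T | `[< linear T /\ continuous T >]].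

Lemma bounded_opP T : reflect (linear T /\ continuous T) (T \in bounded_op).
Proof. exact: asboolP. Qed.

Lemma bounded_op_submod_closed : submod_closed bounded_op.
Proof.
split=> [|a S T].
  apply/bounded_opP; split=> [b u v|x]; last exact: cst_continuous.
  by rewrite /GRing.zero /= scaler0 addr0.
move=> /bounded_opP[Sl Sc] /bounded_opP[Tl Tc]; apply/bounded_opP; split.
  move=> b u v; rewrite !fctE Sl Tl !scalerDr !scalerA mulrC -!addrA.
  by congr (_ + _); rewrite addrCA.
by move=> x; apply: cvgD; [apply: cvgZr; exact: Sc|exact: Tc].
Qed.

HB.instance Definition _ := GRing.isSubmodClosed.Build _ _ bounded_op
  bounded_op_submod_closed.

Record boundedOp := BoundedOp {
  boundedOp_fun :> H -> H;
  boundedOpP : boundedOp_fun \in bounded_op }.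

HB.instance Definition _ := [isSub for boundedOp_fun].
HB.instance Definition _ := [Choice of boundedOp by <:].
HB.instance Definition _ := [SubChoice_isSubLmodule of boundedOp by <:].

Definition bop_act (T : boundedOp) : H -> H := T.

Lemma bop_act_linear T : linear (bop_act T).
Proof. by have /bounded_opP[] := boundedOpP T. Qed.

Lemma bop_linear_act v : linear (bop_act ^~ v).
Proof. by []. Qed.

Lemma bop_act_inj : injective bop_act.
Proof. by move=> S T ST; apply: val_inj. Qed.

HB.instance Definition _ := isOperatorSpace.Build R boundedOp
  (@hdot R H) bop_act_linear bop_linear_act bop_act_inj.

End BoundedOperators.

Notation "''B' ( H )" := (boundedOp H) (at level 8, format "''B' ( H )") : type_scope.

Section OperatorNorm.
Variables (R : realType) (V : Type) (dot : V -> V -> R[i]).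

Definition dot_norm (v : V) : R := Num.sqrt (complex.Re (dot v v)).

Definition op_norm (T : V -> V) : \bar R :=
  ereal_sup [set (dot_norm (T v))%:E | v in [set v | dot_norm v <= 1]].

(* 0 <= z in R[i] means that z is real and nonnegative *)
Definition op_pos (T : V -> V) : Prop := forall v, 0 <= dot (T v) v.

End OperatorNorm.

Section MatrixLevels.
Variables (R : realType) (A : operatorSpaceType R).

Definition os_norm (a : A) : \bar R := op_norm os_dot (os_act a).

Definition amp_dot k (u v : 'I_k -> os_space A) : R[i] :=
  \sum_(i < k) os_dot (u i) (v i).

Definition amp_act k (X : 'M[A]_k) (u : 'I_k -> os_space A) : 'I_k -> os_space A :=
  fun i => \sum_(j < k) os_act (X i j) (u j).

Definition amp_norm k (X : 'M[A]_k) : \bar R := op_norm (@amp_dot k) (amp_act X).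

Definition amp_pos k (X : 'M[A]_k) : Prop := op_pos (@amp_dot k) (amp_act X).

End MatrixLevels.

Section CompletelyBoundedMaps.
Variables (R : realType) (A B : operatorSpaceType R).
Implicit Type f : A -> B.

Definition completely_positive f : Prop :=
  forall k (X : 'M[A]_k), amp_pos X -> amp_pos (map_mx f X).

Definition completely_isometric f : Prop :=
  forall k (X : 'M[A]_k), amp_norm (map_mx f X) = amp_norm X.

Definition contractive f : Prop :=
  forall a, (os_norm (f a) <= os_norm a)%E.

(* cb norm of the restriction of f to the subspace D *)
Definition cb_norm (D : set A) f : \bar R :=
  ereal_sup [set y | exists k (X : 'M[A]_k),
    [/\ forall i j, D (X i j), (amp_norm X <= 1)%E & y = amp_norm (map_mx f X)]].

Definition complete_order_embedding f : Prop :=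
  completely_positive f /\ completely_isometric f.

End CompletelyBoundedMaps.

Section RankOneProjections.
Variable R : realType.

Definition rank1_projection (H : hilbertType R) (p : 'B(H)) : Prop :=
  [/\ forall u, p (p u) = p u,
      forall u v, hdot (p u) v = hdot u (p v) &
      exists2 e : H, e != 0 & range p = [set c *: e | c in [set: R[i]]]].

Definition rank1_projection_mx n (r : 'M[R[i]]_n) : Prop :=
  [/\ r *m r = r, map_mx Num.conj r^T = r & \rank r = 1%N].

End RankOneProjections.

(* Main.v *)
Require Import Defs.
From HB Require Import structures.
From mathcomp Require Import all_boot all_order all_algebra complex.
From mathcomp Require Import all_classical all_reals all_analysis.
From mathcomp Require Import ring lra.
Import Order.TTheory GRing.Theory Num.Theory numFieldNormedType.Exports.
Local Open Scope classical_set_scope.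
Local Open Scope ring_scope.
Set Implicit Arguments.
Unset Strict Implicit.
Unset Printing Implicit Defensive.

(** Throughout, [NH] and [NC] are the squared norms of [H] and of [C^n], and
    [RH], [RC] the real parts of the inner products.

    Write [p h = <h, e> e] for a unit vector [e], and put [s = delta^(1/2)]. If
    [delta] is not tiny, the required bounds exceed [2] and hold trivially: any
    rank one projection and any complete order embedding will do, and the latter
    exist since an injective linear map from [M_n] to [B(H)] forces [H] to have
    dimension at least [n] ([orthonormal_exists]). Suppose that [delta] is small.

    _The projection._ For a unit vector [g], [phi (x - g g^* )] is close to
    [p - phi (g g^* )], an operator between [-1] and [1]; as [phi^-1] has norm at
    most [1 + delta], [x - g g^*] cannot have norm much above [1], so that
    [Re <x g, g> >= - 3 delta]. Hence [x' = (x + x^* )/2 + 3 delta] is positive; its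
    norm is at least [1/2] because [phi x'] is close to [1] at [e], and the
    Cauchy-Schwarz inequality for its quadratic form gives a rank one projection
    [f f^* <= 2 x'] ([rank1_dominated]). Therefore [phi (f f^* )] is of order
    [delta] on the orthogonal of [e].

    _The intertwiner._ Let [W g = phi (g f^* ) e]. By the Schwarz inequality,
    [phi (g f^* )] is of order [s] on the orthogonal of [e], while its norm is
    almost that of [g f^*]; so [W] is isometric up to [4 s] ([intertwiner_ge]). For
    [g = f] this says that [phi (f f^* ) e] is close to [e], which makes
    [phi (f f^* )] close to [p] ([phi_rank1_close]). The norm
    of [phi (a) W - W a] is bounded by the Schwarz defect of the matrices [g f^*] at
    [e], which is of order [s] since [W] is almost isometric
    ([cp_mul_defect], [intertwiner_mul]). This holds for block matrices [a] with
    the same constant, independently of [n] and of the block size.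

    _The embedding._ The polar decomposition replaces [W] by an isometry [U] with
    [|U - W| <= 4 s] ([near_isometry]). The map
    [psi a = U a U^* + (1 - U U^* ) phi a (1 - U U^* )] is a complete order
    embedding ([embed_order_embedding]), being a direct sum of the identity
    representation and a completely positive contraction; since [phi (a) U] is
    close to [U a], and its adjoint relation holds too, [psi] is close to [phi]
    ([embed_close]). All these errors are at most of order [delta^(1/4)], well
    below the stated bounds. *)

(** * Real parts and norms in a complex inner product space *)

Section Complex.
Variable R : realType.
Implicit Types z w : R[i].

(** The squared modulus, as an element of the real field. *)
Definition csq z : R := complex.Re z ^+ 2 + complex.Im z ^+ 2.

Lemma ReJ z : complex.Re z^* = complex.Re z.
Proof. by case: z. Qed.

Lemma ImJ z : complex.Im z^* = - complex.Im z.
Proof. by case: z. Qed.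

Lemma conj_realC (t : R) : (t%:C%C : R[i])^* = t%:C%C.
Proof. by apply/eqP; rewrite eq_complex ReJ ImJ /= oppr0 !eqxx. Qed.

Lemma csq_ge0 z : 0 <= csq z.
Proof. by rewrite addr_ge0 ?sqr_ge0. Qed.

Lemma csq_real (t : R) : csq t%:C%C = t ^+ 2.
Proof. by rewrite /csq /= expr0n addr0. Qed.

Lemma csqM z w : csq (z * w) = csq z * csq w.
Proof. by case: z w => [a b] [c d]; rewrite /csq /=; ring. Qed.

Lemma mulC_conj z : z * z^* = (csq z)%:C%C.
Proof.
case: z => a b; apply/eqP; rewrite eq_complex /csq /=.
by apply/andP; split; apply/eqP; ring.
Qed.

Lemma Re_sum I (s : seq I) (P : pred I) (F : I -> R[i]) :
  complex.Re (\sum_(i <- s | P i) F i) = \sum_(i <- s | P i) complex.Re (F i).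
Proof. by rewrite raddf_sum. Qed.

Lemma ReD z w : complex.Re (z + w) = complex.Re z + complex.Re w.
Proof. exact: raddfD. Qed.

Lemma realCM (a b : R) : (a * b)%:C%C = a%:C%C * b%:C%C :> R[i].
Proof. by rewrite -rmorphM. Qed.

Lemma realCB (a b : R) : (a - b)%:C%C = a%:C%C - b%:C%C :> R[i].
Proof. by rewrite -rmorphB. Qed.

Lemma realC_sum I (s : seq I) (P : pred I) (F : I -> R) :
  (\sum_(i <- s | P i) F i)%:C%C = \sum_(i <- s | P i) (F i)%:C%C :> R[i].
Proof. by rewrite -rmorph_sum. Qed.

Lemma Re_realM (t : R) z : complex.Re (t%:C%C * z) = t * complex.Re z.
Proof. by case: z => a b /=; rewrite mul0r subr0. Qed.

(** A self-conjugate complex number with nonnegative real part is nonnegative. *)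
Lemma ge0_Re_conj z : z^* = z -> 0 <= complex.Re z -> 0 <= z.
Proof.
case: z => a b /eqP; rewrite eq_complex /= => /andP[_ /eqP bN] a0.
rewrite lecE /= a0 andbT eq_sym; apply/eqP; lra.
Qed.

Lemma ge0_Re z : 0 <= z -> 0 <= complex.Re z.
Proof. by rewrite lecE => /andP[]. Qed.

Lemma ge0_real z : 0 <= z -> z = (complex.Re z)%:C%C.
Proof. by case: z => a b; rewrite lecE /= => /andP[/eqP/= -> _]. Qed.

End Complex.

Section InnerProduct.
Variables (R : realType) (V : lmodType R[i]) (dot : {dot V for Num.conj}).
Implicit Types u v w : V.

(** The real part of the inner product: all estimates are carried out in the
    underlying real inner product space. *)
Definition rdot u v : R := complex.Re (dot u v).
Definition nsq v : R := rdot v v.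
Local Notation nm := (dot_norm dot).

Lemma dotC u v : dot u v = (dot v u)^*.
Proof. by rewrite hermC expr0 mul1r. Qed.

Lemma dotDl u v w : dot (u + v) w = dot u w + dot v w.
Proof. by rewrite linearDl. Qed.
Lemma dotDr u v w : dot w (u + v) = dot w u + dot w v.
Proof. by rewrite linearDr. Qed.
Lemma dotBl u v w : dot (u - v) w = dot u w - dot v w.
Proof. by rewrite linearBl. Qed.
Lemma dotZl c u v : dot (c *: u) v = c * dot u v.
Proof. by rewrite linearZl_LR. Qed.
Lemma dotZr c u v : dot u (c *: v) = c^* * dot u v.
Proof. by rewrite linearZr. Qed.
Lemma dot_suml I (s : seq I) (P : pred I) (F : I -> V) v :
  dot (\sum_(i <- s | P i) F i) v = \sum_(i <- s | P i) dot (F i) v.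
Proof. by rewrite linear_sumlz. Qed.
Lemma dot_sumr I (s : seq I) (P : pred I) (F : I -> V) v :
  dot v (\sum_(i <- s | P i) F i) = \sum_(i <- s | P i) dot v (F i).
Proof. by rewrite linear_sumr. Qed.

Lemma rdotC u v : rdot u v = rdot v u.
Proof. by rewrite /rdot dotC ReJ. Qed.

Lemma rdotDl u v w : rdot (u + v) w = rdot u w + rdot v w.
Proof. by rewrite /rdot dotDl raddfD. Qed.
Lemma rdotDr u v w : rdot w (u + v) = rdot w u + rdot w v.
Proof. by rewrite /rdot dotDr raddfD. Qed.
Lemma rdotNl u v : rdot (- u) v = - rdot u v.
Proof. by rewrite /rdot linearNl raddfN. Qed.
Lemma rdotNr u v : rdot u (- v) = - rdot u v.
Proof. by rewrite rdotC rdotNl rdotC. Qed.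
Lemma rdotBl u v w : rdot (u - v) w = rdot u w - rdot v w.
Proof. by rewrite rdotDl rdotNl. Qed.
Lemma rdotBr u v w : rdot w (u - v) = rdot w u - rdot w v.
Proof. by rewrite rdotDr rdotNr. Qed.
Lemma rdotZl (t : R) u v : rdot (t%:C%C *: u) v = t * rdot u v.
Proof. by rewrite /rdot dotZl Re_realM. Qed.
Lemma rdotZr (t : R) u v : rdot u (t%:C%C *: v) = t * rdot u v.
Proof. by rewrite rdotC rdotZl rdotC. Qed.
Lemma rdot_suml I (s : seq I) (P : pred I) (F : I -> V) v :
  rdot (\sum_(i <- s | P i) F i) v = \sum_(i <- s | P i) rdot (F i) v.
Proof. by rewrite /rdot dot_suml raddf_sum. Qed.
Lemma rdot_sumr I (s : seq I) (P : pred I) (F : I -> V) v :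
  rdot v (\sum_(i <- s | P i) F i) = \sum_(i <- s | P i) rdot v (F i).
Proof. by rewrite /rdot dot_sumr raddf_sum. Qed.

Lemma nsq_ge0 v : 0 <= nsq v.
Proof. by apply: ge0_Re; rewrite dnorm_ge0. Qed.

Lemma dot_nsq v : dot v v = (nsq v)%:C%C.
Proof. by apply: ge0_real; rewrite dnorm_ge0. Qed.

Lemma nsq0 : nsq 0 = 0.
Proof. by rewrite /nsq /rdot linear0l. Qed.

Lemma nsq_eq0 v : nsq v = 0 -> v = 0.
Proof. by move=> v0; apply/eqP; rewrite -(dnorm_eq0 dot) dot_nsq v0. Qed.

Lemma nsqD u v : nsq (u + v) = nsq u + nsq v + 2 * rdot u v.
Proof. by rewrite /nsq !rdotDl !rdotDr (rdotC v u); ring. Qed.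

Lemma nsqB u v : nsq (u - v) = nsq u + nsq v - 2 * rdot u v.
Proof. by rewrite /nsq !rdotBl !rdotBr (rdotC v u); ring. Qed.

Lemma nsqZ c v : nsq (c *: v) = csq c * nsq v.
Proof. by rewrite /nsq {1}/rdot dotZl dotZr mulrA mulC_conj Re_realM. Qed.

(** The complex Cauchy-Schwarz inequality. *)
Lemma csq_dot_le u v : csq (dot u v) <= nsq u * nsq v.
Proof.
have [v0|v0] := eqVneq (nsq v) 0.
  by rewrite (nsq_eq0 v0) linear0r nsq0 mulr0 /csq /= expr0n addr0.
have := nsq_ge0 (u - ((nsq v)^-1%:C%C * dot u v) *: v).
rewrite nsqB nsqZ csqM csq_real.
have -> : rdot u (((nsq v)^-1%:C%C * dot u v) *: v) = (nsq v)^-1 * csq (dot u v).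
  rewrite /rdot dotZr rmorphM /= conj_realC -mulrA [_^* * _]mulrC mulC_conj.
  by rewrite -realCM.
set c := csq _ => h; rewrite -ler_pdivrMr ?lt_def ?v0 ?nsq_ge0 //.
have e1 : (nsq v)^-1 ^+ 2 * c * nsq v = c / nsq v by field.
by move: h; rewrite e1 [(nsq v)^-1 * c]mulrC; lra.
Qed.

Lemma csq_dot_unit u v : nsq v = 1 -> csq (dot u v) <= nsq u.
Proof. by move=> v1; have := csq_dot_le u v; rewrite v1 mulr1. Qed.

(** Arithmetic-geometric form of the Cauchy-Schwarz inequality. *)
Lemma rdot_amgm (t : R) u v : 0 < t -> 2 * rdot u v <= t * nsq u + t^-1 * nsq v.
Proof.
move=> t0; have := nsq_ge0 (t%:C%C *: u - v).
rewrite nsqB nsqZ csq_real rdotZl => h.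
have: 0 <= t^-1 * (t ^+ 2 * nsq u + nsq v - 2 * (t * rdot u v)).
  by rewrite mulr_ge0 // invr_ge0 ltW.
have -> : t^-1 * (t ^+ 2 * nsq u + nsq v - 2 * (t * rdot u v)) =
  t * nsq u + t^-1 * nsq v - 2 * rdot u v by field; lra.
lra.
Qed.

Lemma rdot_le_nsq u v : 2 * rdot u v <= nsq u + nsq v.
Proof. by have := @rdot_amgm 1 u v ltr01; rewrite invr1 !mul1r. Qed.

Lemma nsqD_le u v : nsq (u + v) <= 2 * nsq u + 2 * nsq v.
Proof. by rewrite nsqD; have := rdot_le_nsq u v; lra. Qed.

Lemma nsqB_le u v : nsq (u - v) <= 2 * nsq u + 2 * nsq v.
Proof. by have := nsq_ge0 (u + v); rewrite nsqB nsqD; lra. Qed.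

Lemma nm_ge0 v : 0 <= nm v.
Proof. exact: sqrtr_ge0. Qed.

Lemma nm_sqr v : nm v ^+ 2 = nsq v.
Proof. by rewrite sqr_sqrtr // nsq_ge0. Qed.

Lemma nm_le v (M : R) : 0 <= M -> (nm v <= M) = (nsq v <= M ^+ 2).
Proof. by move=> M0; rewrite -nm_sqr ler_sqr ?nnegrE ?nm_ge0. Qed.

Lemma ge_nm v (M : R) : 0 <= M -> (M <= nm v) = (M ^+ 2 <= nsq v).
Proof. by move=> M0; rewrite -nm_sqr ler_sqr ?nnegrE ?nm_ge0. Qed.

Lemma nm_eq0 v : nm v = 0 -> v = 0.
Proof. by move=> v0; apply: nsq_eq0; rewrite -nm_sqr v0 expr0n. Qed.

Lemma nmN v : nm (- v) = nm v.
Proof. by rewrite /dot_norm -/(rdot _ _) rdotNl rdotNr opprK. Qed.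

Lemma nmZ c v : nm (c *: v) = Num.sqrt (csq c) * nm v.
Proof. by rewrite /dot_norm -/(rdot _ _) -/(nsq _) nsqZ sqrtrM ?csq_ge0. Qed.

(** The Cauchy-Schwarz inequality. *)
Lemma rdot_le_nm u v : rdot u v <= nm u * nm v.
Proof.
have [u0|u0] := eqVneq (nm u) 0.
  by rewrite (nm_eq0 u0) /rdot linear0l /= mulr_ge0 ?nm_ge0.
have [v0|v0] := eqVneq (nm v) 0.
  by rewrite (nm_eq0 v0) /rdot linear0r /= mulr_ge0 ?nm_ge0.
have pu : 0 < nm u by rewrite lt_def u0 nm_ge0.
have pv : 0 < nm v by rewrite lt_def v0 nm_ge0.
have := rdot_amgm u v (divr_gt0 pv pu).
rewrite invf_div -!nm_sqr.
have -> : nm v / nm u * nm u ^+ 2 + nm u / nm v * nm v ^+ 2 = 2 * (nm u * nm v).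
  by field; rewrite u0 v0.
lra.
Qed.

Lemma nmD u v : nm (u + v) <= nm u + nm v.
Proof.
rewrite nm_le ?addr_ge0 ?nm_ge0 // nsqD -!nm_sqr.
by have := rdot_le_nm u v; lra.
Qed.

End InnerProduct.

(** * Operator norms as quadratic inequalities *)

Section OpNorm.
Variables (R : realType) (V : lmodType R[i]) (dot : V -> V -> R[i]) (T : V -> V).
Local Notation q v := (complex.Re (dot v v)).
Hypothesis q_ge0 : forall v, 0 <= q v.
Hypothesis qZ : forall (t : R) v, q (t%:C%C *: v) = t ^+ 2 * q v.
Hypothesis TZ : forall (t : R) v, T (t%:C%C *: v) = t%:C%C *: T v.

Lemma op_normP (M : R) : 0 <= M ->
  (op_norm dot T <= M%:E)%E <-> forall v, q (T v) <= M ^+ 2 * q v.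
Proof.
move=> M0; split=> [TM v|TM]; last first.
  apply: ge_ereal_sup => _ [v /= v1 <-]; rewrite lee_fin.
  have qv1 : q v <= 1.
    by rewrite -(expr1n _ 2) -(sqr_sqrtr (q_ge0 v)) ler_sqr ?nnegrE ?sqrtr_ge0.
  rewrite -[leRHS]ger0_norm // -sqrtr_sqr; apply: ler_wsqrtr.
  by rewrite (le_trans (TM v)) // ler_piMr ?sqr_ge0.
have key (s : R) : Num.sqrt (q v) < s -> q (T v) <= M ^+ 2 * s ^+ 2.
  move=> vs; have s0 : 0 < s by apply: le_lt_trans vs; exact: sqrtr_ge0.
  have : ((dot_norm dot (T (s^-1%:C%C *: v)))%:E <= M%:E)%E.
    apply: le_trans TM; apply: ereal_sup_ubound; exists (s^-1%:C%C *: v) => //=.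
    rewrite /dot_norm qZ sqrtrM ?sqr_ge0 // sqrtr_sqr ger0_norm ?invr_ge0 ?(ltW s0) //.
    by rewrite ler_pdivrMl // mulr1 ltW.
  rewrite lee_fin /dot_norm TZ qZ sqrtrM ?sqr_ge0 // sqrtr_sqr.
  rewrite ger0_norm ?invr_ge0 ?(ltW s0) // ler_pdivrMl // mulrC => h.
  rewrite -exprMn -[leLHS]sqr_sqrtr // ler_sqr ?nnegrE ?sqrtr_ge0 //.
  by rewrite mulr_ge0 // ltW.
rewrite -[leLHS]sqr_sqrtr // -[q v]sqr_sqrtr // -exprMn.
rewrite ler_sqr ?nnegrE ?mulr_ge0 ?sqrtr_ge0 //.
apply/ler_addgt0Pr => eps eps0.
pose s := Num.sqrt (q v) + eps / (M + 1).
have M1 : 0 < M + 1 by lra.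
have := key s; rewrite ltrDl divr_gt0 // => /(_ isT).
rewrite -exprMn -{1}[q (T v)]sqr_sqrtr // ler_sqr ?nnegrE ?sqrtr_ge0 //; last first.
  by rewrite mulr_ge0 // addr_ge0 ?sqrtr_ge0 // divr_ge0 ?ltW.
move=> /le_trans; apply; rewrite /s mulrDr lerD2l mulrA ler_pdivrMr //.
by rewrite mulrC ler_pM2l // lerDl.
Qed.

Lemma op_norm_ge0 : (0 <= op_norm dot T)%E.
Proof.
apply: ereal_sup_ubound.
have z0 : q 0 = 0 by have := qZ 0 0; rewrite scaler0 expr0n mul0r.
exists 0; first by rewrite /= /dot_norm z0 sqrtr0.
have -> : T 0 = 0 by have := TZ 0 0; rewrite scaler0 scale0r.
by rewrite /dot_norm z0 sqrtr0.
Qed.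

End OpNorm.

Section OperatorSpaceNorm.
Variables (R : realType) (A : operatorSpaceType R).
Local Notation nsqA := (nsq (os_dot (s := A))).

Lemma os_actZ (a : A) c v : os_act a (c *: v) = c *: os_act a v.
Proof.
have := os_act_linear a c v 0; rewrite !addr0 => ->.
have /eqP := os_act_linear a 1 0 0; rewrite scaler0 addr0 scale1r.
by rewrite -[X in X == _]addr0 (inj_eq (addrI _)) => /eqP <-; rewrite addr0.
Qed.

Lemma os_normP (a : A) (M : R) : 0 <= M ->
  (os_norm a <= M%:E)%E <-> forall v, nsqA (os_act a v) <= M ^+ 2 * nsqA v.
Proof.
apply: op_normP => [v|t v|t v]; first exact: nsq_ge0; last exact: os_actZ.
by have := nsqZ os_dot t%:C%C v; rewrite csq_real.
Qed.

Section Amplification.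
Variable k : nat.
Implicit Types (X : 'M[A]_k) (u : 'I_k -> os_space A).

Lemma Re_amp_dot u : complex.Re (amp_dot u u) = \sum_i nsqA (u i).
Proof. by rewrite /amp_dot raddf_sum. Qed.

Let qZ (t : R) u : complex.Re (amp_dot (t%:C%C *: u) (t%:C%C *: u)) =
  t ^+ 2 * complex.Re (amp_dot u u).
Proof.
rewrite !Re_amp_dot mulr_sumr; apply: eq_bigr => i _.
by rewrite -csq_real -nsqZ.
Qed.

Let actZ X (t : R) u : amp_act X (t%:C%C *: u) = t%:C%C *: amp_act X u.
Proof.
apply/funext => i; rewrite -[RHS]/(t%:C%C *: \sum_j os_act (X i j) (u j)).
rewrite scaler_sumr.
by apply: eq_bigr => j _; rewrite -os_actZ.
Qed.

Let q_ge0 u : 0 <= complex.Re (amp_dot u u).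
Proof. by rewrite Re_amp_dot sumr_ge0 // => i _; exact: nsq_ge0. Qed.

Lemma amp_normP X (M : R) : 0 <= M ->
  (amp_norm X <= M%:E)%E <-> forall u,
    \sum_i nsqA (\sum_j os_act (X i j) (u j)) <= M ^+ 2 * \sum_i nsqA (u i).
Proof.
move=> M0; have := op_normP q_ge0 qZ (actZ X) M0; rewrite /amp_norm => ->.
by split=> h u; have := h u; rewrite !Re_amp_dot.
Qed.

Lemma amp_norm_ge0 X : (0 <= amp_norm X)%E.
Proof. exact: op_norm_ge0 qZ (actZ X). Qed.

End Amplification.
End OperatorSpaceNorm.

(** To compare two operator norms it suffices to compare the real bounds they
    satisfy. *)
Lemma amp_norm_le (R : realType) (A B : operatorSpaceType R) k
    (X : 'M[A]_k) (Y : 'M[B]_k) :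
    (forall M : R, 0 <= M -> (amp_norm Y <= M%:E)%E -> (amp_norm X <= M%:E)%E) ->
  (amp_norm X <= amp_norm Y)%E.
Proof.
move=> XY; have := amp_norm_ge0 Y.
case E: (amp_norm Y) => [M| |] // M0; last by rewrite leey.
by apply: XY => //; rewrite E.
Qed.

(** * Adjoints and rank one matrices *)

HB.instance Definition _ (R : realType) (H : hilbertType R) (T : 'B(H)) :=
  GRing.isLinear.Build R[i] H H _ (boundedOp_fun T) (bop_act_linear T).

Section Adjoint.
Variable R : realType.
Local Notation C := R[i].

(** The adjoint matrix. *)
Definition adjmx m n (A : 'M[C]_(m, n)) : 'M[C]_(n, m) := map_mx Num.conj A^T.

Lemma adjmxK m n (A : 'M[C]_(m, n)) : adjmx (adjmx A) = A.
Proof. by apply/matrixP => i j; rewrite !mxE conjCK. Qed.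

Lemma adjmxM m n p (A : 'M[C]_(m, n)) (B : 'M[C]_(n, p)) :
  adjmx (A *m B) = adjmx B *m adjmx A.
Proof. by rewrite /adjmx trmx_mul map_mxM. Qed.

Lemma adjmx1 n : adjmx (1%:M : 'M[C]_n) = 1%:M.
Proof. by rewrite /adjmx trmx1 map_mx1. Qed.

Lemma adjmxD m n (A B : 'M[C]_(m, n)) : adjmx (A + B) = adjmx A + adjmx B.
Proof. by rewrite /adjmx linearD map_mxD. Qed.

Lemma adjmxB m n (A B : 'M[C]_(m, n)) : adjmx (A - B) = adjmx A - adjmx B.
Proof. by rewrite /adjmx linearB map_mxB. Qed.

Lemma adjmxZ m n c (A : 'M[C]_(m, n)) : adjmx (c *: A) = c^* *: adjmx A.
Proof. by rewrite /adjmx linearZ /= map_mxZ. Qed.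

Lemma cdot_mulmx n (u v : 'cV[C]_n) : cdot u v = (adjmx v *m u) 0 0.
Proof. by rewrite mxE; apply: eq_bigr => i _; rewrite !mxE mulrC. Qed.

Lemma cdot_adjmx m n (A : 'M[C]_(m, n)) u v :
  cdot (A *m u) v = cdot u (adjmx A *m v).
Proof. by rewrite !cdot_mulmx adjmxM adjmxK mulmxA. Qed.

Lemma rdot_adjmx m n (A : 'M[C]_(m, n)) u v :
  rdot (@cdot R m) (A *m u) v = rdot (@cdot R n) u (adjmx A *m v).
Proof. by rewrite /rdot /= cdot_adjmx. Qed.

(** The rank one operator sending [f] to [g] when [f] is a unit vector. *)
Definition outer n (g f : 'cV[C]_n) : 'M[C]_n := g *m adjmx f.

Section Outer.
Variable n : nat.
Implicit Types f g u v : 'cV[C]_n.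

Lemma outer_mulmx g f u : outer g f *m u = cdot u f *: g.
Proof.
rewrite /outer -mulmxA; apply/colP => i.
by rewrite !mxE big_ord1 cdot_mulmx mulrC.
Qed.

Lemma mulmx_outer (A : 'M[C]_n) g f : A *m outer g f = outer (A *m g) f.
Proof. by rewrite /outer mulmxA. Qed.

Lemma adjmx_outer g f : adjmx (outer g f) = outer f g.
Proof. by rewrite /outer adjmxM adjmxK. Qed.

Lemma outerZl c g f : outer (c *: g) f = c *: outer g f.
Proof. by rewrite /outer scalemxAl. Qed.

Lemma outerDl g1 g2 f : outer (g1 + g2) f = outer g1 f + outer g2 f.
Proof. by rewrite /outer mulmxDl. Qed.

Lemma outerM g f u v : outer g f *m outer u v = cdot u f *: outer g v.
Proof. by rewrite mulmx_outer outer_mulmx outerZl. Qed.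

Lemma rank1_outer f : nsq (@cdot R n) f = 1 -> rank1_projection_mx (outer f f).
Proof.
move=> f1; have ff : cdot f f = 1.
  by rewrite (dot_nsq (@cdot R n)) f1.
split; [by rewrite outerM ff scale1r|exact: adjmx_outer|].
apply/eqP; rewrite eqn_leq (leq_trans (mxrankM_maxl _ _)) ?rank_leq_col //.
rewrite lt0n mxrank_eq0; apply/eqP => r0.
have := outer_mulmx f f f; rewrite r0 mul0mx ff scale1r => f0.
by move: f1; rewrite -f0 nsq0 => /eqP; rewrite eq_sym oner_eq0.
Qed.

End Outer.
End Adjoint.

Section BoundedOpTheory.
Variables (R : realType) (H : hilbertType R).
Implicit Types S T : 'B(H).

Lemma bopD S T h : (S + T) h = S h + T h. Proof. by []. Qed.
Lemma bopB S T h : (S - T) h = S h - T h. Proof. by []. Qed.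
Lemma bop_sum I (s : seq I) (P : pred I) (F : I -> 'B(H)) h :
  (\sum_(i <- s | P i) F i) h = \sum_(i <- s | P i) F i h.
Proof. by elim/big_rec2: _ => // i y T _ <-. Qed.

Lemma bopDr T h k : T (h + k) = T h + T k. Proof. exact: linearD. Qed.
Lemma bopNr T h : T (- h) = - T h. Proof. exact: linearN. Qed.
Lemma bopBr T h k : T (h - k) = T h - T k. Proof. exact: linearB. Qed.
Lemma bopZr T c h : T (c *: h) = c *: T h. Proof. exact: linearZ. Qed.
Lemma bopr_sum T I (s : seq I) (P : pred I) (F : I -> H) :
  T (\sum_(i <- s | P i) F i) = \sum_(i <- s | P i) T (F i).
Proof. exact: linear_sum. Qed.

Variables (n : nat) (phi : {linear 'M[R[i]]_n -> 'B(H)}).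

Lemma opmapD a b h : phi (a + b) h = phi a h + phi b h.
Proof. by rewrite linearD. Qed.
Lemma opmapN a h : phi (- a) h = - phi a h.
Proof. by rewrite linearN. Qed.
Lemma opmapB a b h : phi (a - b) h = phi a h - phi b h.
Proof. by rewrite linearB. Qed.
Lemma opmapZ c a h : phi (c *: a) h = c *: phi a h.
Proof. by rewrite linearZ. Qed.
Lemma opmap_sum I (s : seq I) (P : pred I) (F : I -> 'M[R[i]]_n) h :
  phi (\sum_(i <- s | P i) F i) h = \sum_(i <- s | P i) phi (F i) h.
Proof. by rewrite linear_sum bop_sum. Qed.

Lemma bop_ext S T : (forall h, S h = T h) -> S = T.
Proof. by move=> ST; apply/val_inj/funext. Qed.

End BoundedOpTheory.

(** * Schwarz inequalities for completely positive maps *)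

Section BigOption.
Variables (V : nmodType) (I : finType).

Lemma sum_option (F : option I -> V) : \sum_o F o = F None + \sum_i F (Some i).
Proof.
rewrite (bigD1 None) //=; congr (_ + _).
rewrite (reindex_omap Some id) //=; last by case.
by apply: eq_bigl => i; rewrite eqxx.
Qed.

End BigOption.

Section CompletelyPositive.
Variables (R : realType) (n : nat) (H : hilbertType R).
Variable phi : {linear 'M[R[i]]_n -> 'B(H)}.
Hypothesis phi_cp : completely_positive phi.
Hypothesis phi1 : forall h, rdot (@hdot R H) (phi 1%:M h) h <= nsq (@hdot R H) h.

Local Notation C := R[i].
Local Notation NH := (nsq (@hdot R H)).
Local Notation RH := (rdot (@hdot R H)).
Local Notation NC := (nsq (@cdot R n)).
Local Notation RC := (rdot (@cdot R n)).

Lemma cp_amp k (X : 'M['M[C]_n]_k) (h : 'I_k -> H) :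
  (forall u : 'I_k -> 'cV[C]_n,
     0 <= \sum_i \sum_j cdot (X i j *m u j) (u i)) ->
  0 <= \sum_i \sum_j hdot (phi (X i j) (h j)) (h i).
Proof.
move=> X0; have : amp_pos X.
  move=> u; have := X0 u; congr (0 <= _); rewrite /amp_dot; apply: eq_bigr => i _.
  by rewrite (linear_sumlz (@cdot R n)).
move=> /phi_cp /(_ h); congr (0 <= _); rewrite /amp_dot; apply: eq_bigr => i _.
rewrite (linear_sumlz (@hdot R H)); apply: eq_bigr => j _.
by rewrite mxE.
Qed.

(** Positivity of the kernel [phi (x_i^* x_j)], over any finite index type. *)
Lemma cp_gram (I : finType) (x : I -> 'M[C]_n) (h : I -> H) :
  0 <= \sum_i \sum_j hdot (phi (adjmx (x i) *m x j) (h j)) (h i).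
Proof.
have := @cp_amp #|I| (\matrix_(i, j) (adjmx (x (enum_val i)) *m x (enum_val j)))
  (fun i => h (enum_val i)).
have toI (F : I -> I -> C) : \sum_i \sum_j F i j =
    \sum_(i < #|I|) \sum_(j < #|I|) F (enum_val i) (enum_val j).
  rewrite (reindex _ (onW_bij _ (@enum_val_bij I))); apply: eq_bigr => i _.
  by rewrite (reindex _ (onW_bij _ (@enum_val_bij I))).
rewrite (toI (fun i j => hdot (phi (adjmx (x i) *m x j) (h j)) (h i))).
move=> amp; suff pos (u : 'I_#|I| -> 'cV[C]_n) : 0 <= \sum_i \sum_j
    cdot ((\matrix_(i0, j0) (adjmx (x (enum_val i0)) *m x (enum_val j0))) i j
           *m u j) (u i).
  move/(_ pos): amp; congr (0 <= _); apply: eq_bigr => i _.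
  by apply: eq_bigr => j _; rewrite mxE.
pose v := \sum_j x (enum_val j) *m u j.
suff -> : \sum_i \sum_j
    cdot ((\matrix_(i0, j0) (adjmx (x (enum_val i0)) *m x (enum_val j0))) i j
           *m u j) (u i) = cdot v v.
  by have := dnorm_ge0 (@cdot R n) v.
rewrite [RHS](dot_suml (@cdot R n)) exchange_big /=; apply: eq_bigr => j _.
rewrite [RHS](dot_sumr (@cdot R n)); apply: eq_bigr => i _.
by rewrite mxE -mulmxA cdot_adjmx adjmxK.
Qed.

(** A completely positive map preserves adjoints. *)
Lemma cp_adj a h k : hdot (phi (adjmx a) h) k = hdot h (phi a k).
Proof.
have Im0 (z : C) : 0 <= z -> complex.Im z = 0 by move/ger0_Im.
have imag (c : H) : complex.Im (hdot (phi (adjmx a) h) c) = - complex.Im (hdot (phi a c) h).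
  have := cp_gram (fun b : bool => if b then a else 1%:M)
    (fun b => if b then c else h).
  have := cp_gram (fun _ : 'I_1 => a) (fun=> c).
  have := cp_gram (fun _ : 'I_1 => 1%:M) (fun=> h).
  rewrite !big_bool /= !big_ord1 adjmx1 !mul1mx mulmx1.
  move=> /Im0 h1 /Im0 h2 /Im0; rewrite !raddfD /= h1 h2; lra.
(* the real parts follow by replacing [c] with ['i c] *)
have re c : complex.Re (hdot (phi (adjmx a) h) c) = complex.Re (hdot (phi a c) h).
  have := imag ('i%C *: c).
  rewrite [phi a _]linearZ /= (dotZr (@hdot R H)) (dotZl (@hdot R H)).
  have -> : ('i%C : C)^* = - 'i%C by apply/eqP; rewrite eq_complex /= oppr0 !eqxx.
  by case: (hdot _ _) => p q; case: (hdot _ _) => p' q' /=; lra.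
rewrite [RHS](dotC (@hdot R H)); apply/eqP; rewrite eq_complex.
by rewrite ReJ ImJ re imag !eqxx.
Qed.

Lemma cp_rdot_adj a h k : RH (phi (adjmx a) h) k = RH h (phi a k).
Proof. by rewrite /rdot /= cp_adj. Qed.

(** Kadison-Schwarz inequality for a row [(x_i)] applied to a column [(h_i)];
    it is the positivity of the kernel above on the family extended by the
    identity, with the vector [- \sum_i phi (x_i) h_i]. *)
Lemma cp_schwarz (I : finType) (x : I -> 'M[C]_n) (h : I -> H) :
  NH (\sum_i phi (x i) (h i)) <=
    \sum_i \sum_j RH (phi (adjmx (x i) *m x j) (h j)) (h i).
Proof.
pose z := \sum_i phi (x i) (h i); rewrite -/z.
have := cp_gram (fun o : option I => if o is Some i then x i else 1%:M)
  (fun o => if o is Some i then h i else - z).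
move/ge0_Re; rewrite !sum_option /= adjmx1 mul1mx.
under [X in _ + X]eq_bigr => i _ do rewrite sum_option mulmx1 /=.
rewrite big_split /= !ReD !Re_sum.
under [X in _ + X + _]eq_bigr => i _ do rewrite mul1mx -/(RH _ _) rdotNr rdotC.
under [X in _ + (X + _)]eq_bigr => i _ do
  rewrite -/(RH _ _) cp_rdot_adj rdotNl rdotC.
under [X in _ + (_ + X)]eq_bigr => i _ do rewrite Re_sum.
rewrite !sumrN -/(RH _ _) bopNr rdotNl rdotNr opprK -rdot_sumr -rdot_suml -/z.
by have := phi1 z; rewrite /nsq; lra.
Qed.

(** If the block matrix [X] has norm at most [M], then
    [phi (X^* X) <= M^2 phi 1 <= M^2]. *)
Lemma cp_gram_le k (X : 'I_k -> 'I_k -> 'M[C]_n) (M : R) (h : 'I_k -> H) :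
  (forall u : 'I_k -> 'cV[C]_n,
     \sum_l NC (\sum_j X l j *m u j) <= M ^+ 2 * \sum_i NC (u i)) ->
  \sum_l \sum_i \sum_j RH (phi (adjmx (X l i) *m X l j) (h j)) (h i)
    <= M ^+ 2 * \sum_i NH (h i).
Proof.
move=> XM.
pose Y : 'M['M[C]_n]_k := \matrix_(i, j)
  ((M ^+ 2)%:C%C *: (if i == j then 1%:M else 0)
     - \sum_l adjmx (X l i) *m X l j).
have Y0 (u : 'I_k -> 'cV[C]_n) : 0 <= \sum_i \sum_j cdot (Y i j *m u j) (u i).
  have -> : \sum_i \sum_j cdot (Y i j *m u j) (u i) =
     (M ^+ 2 * \sum_i NC (u i) - \sum_l NC (\sum_j X l j *m u j))%:C%C.
    rewrite realCB realCM !realC_sum mulr_sumr.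
    have -> : \sum_l (NC (\sum_j X l j *m u j))%:C%C =
        \sum_i \sum_j \sum_l cdot (X l j *m u j) (X l i *m u i).
      under [RHS]eq_bigr => i _ do rewrite exchange_big /=.
      rewrite [RHS]exchange_big /=; apply: eq_bigr => l _.
      rewrite -(dot_nsq (@cdot R n)) (dot_sumr (@cdot R n)); apply: eq_bigr => i _.
      by rewrite (dot_suml (@cdot R n)).
    rewrite -sumrB; apply: eq_bigr => i _.
    rewrite (bigD1 i) //= [X in _ = _ - X](bigD1 i) //= opprD addrA; congr (_ + _).
      rewrite mxE eqxx mulmxBl (dotBl (@cdot R n)) -scalemxAl mul1mx.
      rewrite (dotZl (@cdot R n)) (dot_nsq (@cdot R n)); congr (_ - _).
      rewrite mulmx_suml (dot_suml (@cdot R n)); apply: eq_bigr => l _.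
      by rewrite -mulmxA [LHS]cdot_adjmx adjmxK.
    rewrite -sumrN; apply: eq_bigr => j ji.
    rewrite mxE eq_sym (negPf ji) scaler0 sub0r mulNmx (linearNl (@cdot R n)) /=.
    congr (- _); rewrite mulmx_suml (dot_suml (@cdot R n)); apply: eq_bigr => l _.
    by rewrite -mulmxA [LHS]cdot_adjmx adjmxK.
  by rewrite ler0c subr_ge0.
have := cp_amp h Y0 => /ge0_Re; rewrite Re_sum.
have -> : \sum_i complex.Re (\sum_j hdot (phi (Y i j) (h j)) (h i)) =
    \sum_i M ^+ 2 * RH (phi 1%:M (h i)) (h i) -
    \sum_l \sum_i \sum_j RH (phi (adjmx (X l i) *m X l j) (h j)) (h i).
  rewrite [X in _ - X]exchange_big -sumrB; apply: eq_bigr => i _ /=.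
  rewrite [X in _ - X]exchange_big Re_sum /=.
  rewrite (bigD1 i) //= [X in _ = _ - X](bigD1 i) //= opprD addrA; congr (_ + _).
    rewrite mxE eqxx opmapB opmapZ -/(RH _ _) rdotBl rdotZl.
    by rewrite opmap_sum rdot_suml.
  rewrite -sumrN; apply: eq_bigr => j ji.
  rewrite mxE eq_sym (negPf ji) scaler0 sub0r opmapN -/(RH _ _) rdotNl.
  by rewrite opmap_sum rdot_suml.
rewrite subr_ge0 => /le_trans; apply; rewrite mulr_sumr.
by apply: ler_sum => i _; rewrite ler_wpM2l ?sqr_ge0.
Qed.

(** A completely positive contraction is completely contractive. *)
Lemma cp_contractive k (X : 'I_k -> 'I_k -> 'M[C]_n) (M : R) (h : 'I_k -> H) :
  (forall u : 'I_k -> 'cV[C]_n,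
     \sum_l NC (\sum_j X l j *m u j) <= M ^+ 2 * \sum_i NC (u i)) ->
  \sum_l NH (\sum_j phi (X l j) (h j)) <= M ^+ 2 * \sum_i NH (h i).
Proof.
move=> XM; apply: le_trans (cp_gram_le h XM).
by apply: ler_sum => l _; exact: cp_schwarz.
Qed.

Lemma cp_contractive1 a (M : R) h :
  (forall u, NC (a *m u) <= M ^+ 2 * NC u) -> NH (phi a h) <= M ^+ 2 * NH h.
Proof.
move=> aM; have := @cp_contractive 1 (fun _ _ => a) M (fun=> h).
by rewrite !big_ord1; apply=> u; rewrite !big_ord1.
Qed.

(** The Schwarz inequality for a single matrix. *)
Lemma cp_schwarz1 a h : NH (phi a h) <= RH (phi (adjmx a *m a) h) h.
Proof.
by have := cp_schwarz (fun _ : 'I_1 => a) (fun=> h); rewrite !big_ord1.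
Qed.

Lemma cp_pos a h : adjmx a = a -> (forall u, 0 <= RC (a *m u) u) ->
  0 <= RH (phi a h) h.
Proof.
move=> aa a0; have := @cp_amp 1 (const_mx a) (fun=> h).
rewrite !big_ord1 !mxE => ah; apply/ge0_Re/ah => u; rewrite !big_ord1 mxE.
apply: ge0_Re_conj; last exact: a0.
by rewrite -(dotC (@cdot R n)) /= cdot_adjmx aa.
Qed.

(** Approximate multiplicativity: the defect of [phi (a b) = phi a phi b] on
    [xi], for a block contraction [a] and a column [b], is controlled by the
    Schwarz defect of [b] at [xi]. *)
Lemma cp_mul_defect k (a : 'I_k -> 'I_k -> 'M[C]_n) (b : 'I_k -> 'M[C]_n) xi :
  (forall u : 'I_k -> 'cV[C]_n,
     \sum_l NC (\sum_j adjmx (a j l) *m u j) <= \sum_i NC (u i)) ->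
  \sum_i NH (\sum_l (phi (a i l) (phi (b l) xi) - phi (a i l *m b l) xi)) <=
  \sum_l (RH (phi (adjmx (b l) *m b l) xi) xi - NH (phi (b l) xi)).
Proof.
move=> a1; pose d i := \sum_l (phi (a i l) (phi (b l) xi) - phi (a i l *m b l) xi).
have row l : NH (phi (b l) xi) + 2 * \sum_i RH (phi (a i l) (phi (b l) xi)) (d i)
  <= RH (phi (adjmx (b l) *m b l) xi) xi
   + 2 * \sum_i RH (phi (a i l *m b l) xi) (d i)
   + \sum_i \sum_j RH (phi (adjmx (adjmx (a i l)) *m adjmx (a j l)) (d j)) (d i).
  have := cp_schwarz (fun o : option 'I_k => if o is Some i then adjmx (a i l) else b l)
    (fun o => if o is Some i then d i else xi).
  rewrite !sum_option /=.
  under [X in _ <= _ + X]eq_bigr => i _ do rewrite sum_option /=.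
  rewrite big_split /= nsqD rdot_sumr.
  under [X in _ + _ + 2 * X <= _]eq_bigr => i _ do rewrite rdotC cp_rdot_adj rdotC.
  under [X in _ <= _ + X + _]eq_bigr => i _ do
    rewrite -adjmxM cp_rdot_adj rdotC.
  under [X in _ <= _ + (X + _)]eq_bigr => i _ do rewrite adjmxK.
  have := nsq_ge0 (@hdot R H) (\sum_i phi (adjmx (a i l)) (d i)); lra.
have a1' (u : 'I_k -> 'cV[C]_n) :
    \sum_l NC (\sum_j adjmx (a j l) *m u j) <= 1 ^+ 2 * \sum_i NC (u i).
  by rewrite expr1n mul1r; exact: a1.
have := cp_gram_le d a1'; rewrite expr1n mul1r.
have := ler_sum (index_enum 'I_k) (P := xpredT) (fun l _ => row l).
rewrite !big_split /= -!mulr_sumr sumrN.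
rewrite [X in _ + 2 * X <= _]exchange_big [X in _ <= _ + 2 * X + _]exchange_big /=.
have -> : \sum_i \sum_l RH (phi (a i l) (phi (b l) xi)) (d i) =
  \sum_i NH (d i) + \sum_i \sum_l RH (phi (a i l *m b l) xi) (d i).
  rewrite -big_split; apply: eq_bigr => i _ /=.
  rewrite /nsq {1}/d rdot_suml -big_split; apply: eq_bigr => l _ /=.
  by rewrite rdotBl subrK.
rewrite -/d; lra.
Qed.

End CompletelyPositive.

(** * The rank one projection in the matrix algebra *)

Section RankOne.
Variables (R : realType) (H : hilbertType R).
Local Notation NH := (nsq (@hdot R H)).
Local Notation RH := (rdot (@hdot R H)).

Lemma rank1_projectionP (p : 'B(H)) : rank1_projection p ->
  exists e : H, NH e = 1 /\ forall h, p h = hdot h e *: e.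
Proof.
move=> [pp psym [e0 e00 pE]].
have c0 : 0 < NH e0.
  rewrite lt_def nsq_ge0 andbT; apply: contra_neq e00; exact: nsq_eq0.
pose t := Num.sqrt (NH e0); have t0 : 0 < t by rewrite sqrtr_gt0.
pose e := t^-1%:C%C *: e0; exists e.
have Ne : NH e = 1.
  rewrite /e nsqZ csq_real -[NH e0]sqr_sqrtr ?nsq_ge0 // -/t -exprMn.
  by rewrite mulVf ?expr1n // gt_eqF.
split=> // h.
have pe : p e = e.
  have : range p e0 by rewrite pE; exists 1; rewrite ?scale1r.
  by case=> k _ ke; rewrite /e bopZr -ke pp.
have [c ce] : exists c, p h = c *: e.
  have : range p (p h) by exists h.
  rewrite pE => -[c _ ch]; exists (c * t%:C%C); rewrite -ch /e scalerA -mulrA.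
  by rewrite -realCM mulfV ?gt_eqF // mulr1.
have := psym h e; rewrite pe ce (dotZl (@hdot R H)) (dot_nsq (@hdot R H)) Ne.
by rewrite mulr1 => <-.
Qed.

(** A self-adjoint operator between [-1] and [1] is a contraction. *)
Lemma selfadjoint_contraction (T : 'B(H)) :
  (forall h k, RH (T h) k = RH h (T k)) ->
  (forall h, - NH h <= RH (T h) h <= NH h) ->
  forall h, NH (T h) <= NH h.
Proof.
(* polarise the quadratic form of [T] at [h + T h] and [h - T h] *)
move=> Tsym T1 h; set k := T h.
have /andP[_ h1] := T1 (h + k); have /andP[h2 _] := T1 (h - k).
move: h1 h2; rewrite bopDr bopBr !rdotDl !rdotDr !rdotNl !rdotNr nsqD nsqB.
have -> : RH (T k) h = RH (T h) k by rewrite Tsym rdotC.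
rewrite -/k /nsq; lra.
Qed.

End RankOne.

Section FindRankOne.
Variables (R : realType) (n : nat) (H : hilbertType R).
Variable phi : {linear 'M[R[i]]_n -> 'B(H)}.
Hypothesis phi_cp : completely_positive phi.
Local Notation C := R[i].
Local Notation NH := (nsq (@hdot R H)).
Local Notation RH := (rdot (@hdot R H)).
Local Notation NC := (nsq (@cdot R n)).
Local Notation RC := (rdot (@cdot R n)).
Local Notation nmH := (dot_norm (@hdot R H)).
Local Notation nmC := (dot_norm (@cdot R n)).
Hypothesis phi1 : forall h, RH (phi 1%:M h) h <= NH h.
Variable delta : R.
Hypothesis delta_gt0 : 0 < delta.
Hypothesis delta_small : delta <= 100^-1.
Hypothesis phi_inv : forall y (M : R), 0 <= M ->
  (forall h, NH (phi y h) <= M ^+ 2 * NH h) ->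
  forall u, NC (y *m u) <= ((1 + delta) * M) ^+ 2 * NC u.
Variables (e : H) (p : 'B(H)) (x : 'M[C]_n).
Hypothesis e1 : NH e = 1.
Hypothesis pE : forall h, p h = hdot h e *: e.
Hypothesis phi_x : forall h, NH (phi x h - hdot h e *: e) <= delta ^+ 2 * NH h.

Lemma rdot_proj h : RH (hdot h e *: e) h = csq (hdot h e).
Proof.
by rewrite /rdot (dotZl (@hdot R H)) (dotC _ e h) mulC_conj.
Qed.

Lemma nm_phi_x h : nmH (phi x h - hdot h e *: e) <= delta * nmH h.
Proof.
by rewrite nm_le ?mulr_ge0 ?nm_ge0 ?(ltW delta_gt0) // exprMn !nm_sqr.
Qed.

Lemma nsq_scale_unit (u : 'cV[C]_n) : NC u != 0 ->
  NC ((nmC u)^-1%:C%C *: u) = 1.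
Proof.
move=> u0; rewrite nsqZ csq_real exprVn nm_sqr mulVf //.
Qed.

Lemma rdot_outer_ge0 f h : 0 <= RH (phi (outer f f) h) h.
Proof.
apply: cp_pos => //; first exact: adjmx_outer.
move=> u; rewrite outer_mulmx /rdot (dotZl (@cdot R n)) (dotC _ f u) mulC_conj.
exact: csq_ge0.
Qed.

(** If [g] is a unit vector, the operator [phi (x - g g^* )] is close to
    [p - phi (g g^* )], which lies between [-1] and [1]; its preimage under the
    near isometry [phi] hence cannot have norm much larger than one, so that [x]
    is almost positive. *)
Lemma near_pos_unit g : NC g = 1 -> - (3 * delta) <= RC (x *m g) g.
Proof.
have d0 := delta_gt0; have d1 := delta_small; move=> g1; pose y := x - outer g g.
have Q0 h := rdot_outer_ge0 g h.
have Q1 h : RH (phi (outer g g) h) h <= NH h.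
  have : NH (phi (outer g g) h) <= 1 ^+ 2 * NH h.
    apply: cp_contractive1 => // u; rewrite outer_mulmx nsqZ g1 mulr1 expr1n mul1r.
    exact: csq_dot_unit.
  by rewrite expr1n mul1r; have := rdot_le_nsq (@hdot R H) (phi (outer g g) h) h; lra.
have A1 h : NH (p h - phi (outer g g) h) <= NH h.
  rewrite -bopB; apply: selfadjoint_contraction => {}h => [k|].
    rewrite !bopB rdotBl rdotBr !pE; congr (_ - _).
      rewrite /rdot (dotZl (@hdot R H)) (dotZr (@hdot R H)) mulrC.
      by rewrite -(dotC (@hdot R H)).
    by rewrite -cp_rdot_adj // adjmx_outer.
  rewrite bopB rdotBl pE rdot_proj.
  have := Q0 h; have := Q1 h; have := csq_dot_unit (dot := @hdot R H) h e1.
  have := csq_ge0 (hdot h e).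
  by move=> *; apply/andP; split; lra.
have y_le h : NH (phi y h) <= (1 + delta) ^+ 2 * NH h.
  have -> : phi y h = (p h - phi (outer g g) h) + (phi x h - hdot h e *: e).
    rewrite opmapB pE [RHS]addrC addrA; congr (_ - _); by rewrite subrK.
  rewrite -[NH h]nm_sqr -exprMn -nm_le; last first.
    by rewrite mulr_ge0 ?nm_ge0 //; have := delta_gt0; lra.
  apply: le_trans (nmD _ _ _) _; rewrite mulrDl mul1r lerD ?nm_phi_x //.
  by rewrite nm_le ?nm_ge0 // nm_sqr.
have := phi_inv _ y_le g; rewrite g1 mulr1 => /(_ _) yg.
have {}yg : NC (y *m g) <= ((1 + delta) * (1 + delta)) ^+ 2 by apply: yg; lra.
have : - RC (y *m g) g <= (1 + delta) * (1 + delta).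
  rewrite -rdotNl; apply: le_trans (rdot_le_nm _ _ _) _.
  have -> : nmC g = 1 by rewrite /dot_norm -/(rdot _ _ _) -/(nsq _ _) g1 sqrtr1.
  by rewrite mulr1 nmN nm_le ?mulr_ge0 //; lra.
rewrite mulmxBl rdotBl outer_mulmx (dot_nsq (@cdot R n)) g1 scale1r.
rewrite -/(nsq _ _) g1 => h.
have := mulr_ge0 (ltW delta_gt0) (ltW delta_gt0); nra.
Qed.

Lemma near_pos u : - (3 * delta) * NC u <= RC (x *m u) u.
Proof.
have [u0|u0] := eqVneq (NC u) 0.
  by rewrite (nsq_eq0 u0) nsq0 mulr0 mulmx0 /rdot linear0l.
have := near_pos_unit (nsq_scale_unit u0).
rewrite -scalemxAr rdotZl rdotZr mulrA -expr2 exprVn nm_sqr.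
by rewrite ler_pdivlMl ?[NC u * _]mulrC // lt_def u0 nsq_ge0.
Qed.

(** The positive matrix obtained by shifting the self-adjoint part of [x]. *)
Definition shifted : 'M[C]_n := (2^-1)%:C%C *: (x + adjmx x) + (3 * delta)%:C%C *: 1%:M.

Lemma shifted_adj : adjmx shifted = shifted.
Proof.
by rewrite /shifted adjmxD !adjmxZ !conj_realC adjmx1 adjmxD adjmxK [adjmx x + x]addrC.
Qed.

Lemma shifted_rdot u : RC (shifted *m u) u = RC (x *m u) u + 3 * delta * NC u.
Proof.
rewrite /shifted mulmxDl -!scalemxAl mul1mx mulmxDl rdotDl !rdotZl rdotDl.
rewrite (rdot_adjmx (adjmx x)) adjmxK [rdot _ u (x *m u)]rdotC.
by rewrite -/(nsq _ _); congr (_ + _); lra.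
Qed.

Lemma shifted_ge0 u : 0 <= RC (shifted *m u) u.
Proof. by rewrite shifted_rdot; have := near_pos u; lra. Qed.

Lemma shifted_phi h : RH (phi shifted h) h = RH (phi x h) h + 3 * delta * RH (phi 1%:M h) h.
Proof.
rewrite /shifted opmapD !opmapZ opmapD rdotDl !rdotZl rdotDl.
rewrite cp_rdot_adj // [RH h (phi x h)]rdotC.
by congr (_ + _); lra.
Qed.

Lemma shifted_large : exists g, NC g = 1 /\ (2^-1) ^+ 2 <= NC (shifted *m g).
Proof.
apply: contrapT => /forallNP noP.
have shifted_small u : NC (shifted *m u) <= (2^-1) ^+ 2 * NC u.
  have [u0|u0] := eqVneq (NC u) 0.
    by rewrite (nsq_eq0 u0) mulmx0 nsq0 mulr0.
  have /not_andP[|/negP] := noP ((nmC u)^-1%:C%C *: u).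
    by rewrite nsq_scale_unit.
  rewrite -ltNge -scalemxAr nsqZ csq_real [(nmC u)^-1 ^+ 2]exprVn nm_sqr => /ltW.
  by rewrite ler_pdivrMl ?[NC u * _]mulrC // lt_def u0 nsq_ge0.
have ne : nmH e = 1 by rewrite /dot_norm -/(rdot _ _ _) -/(nsq _ _) e1 sqrtr1.
have h1 : RH (phi shifted e) e <= 2^-1.
  apply: le_trans (rdot_le_nm _ _ _) _; rewrite ne mulr1 nm_le ?invr_ge0 //.
  by have := cp_contractive1 phi_cp phi1 e shifted_small; rewrite e1 mulr1.
have h2 := nm_phi_x e.
have h3 := rdot_le_nm (@hdot R H) (- (phi x e - hdot e e *: e)) e.
move: h1 h2 h3; rewrite nmN ne !mulr1 shifted_phi rdotNl rdotBl rdot_proj.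
rewrite (dot_nsq (@hdot R H)) e1 csq_real expr1n.
have : 0 <= RH (phi 1%:M e) e.
  apply: cp_pos => //; first exact: adjmx1.
  by move=> u; rewrite mul1mx; exact: nsq_ge0.
move: delta_gt0 delta_small => d0 d1 p0 *.
have : 0 <= 3 * delta * RH (phi 1%:M e) e by rewrite !mulr_ge0 // ltW.
lra.
Qed.

(** Since [shifted] is positive, [shifted >= m f f^*] for [f = shifted g / m] and
    [m = |shifted g|], by the Cauchy-Schwarz inequality for the form of [shifted]. *)
Lemma rank1_dominated : exists f : 'cV[C]_n, NC f = 1 /\
  forall h, hdot h e = 0 -> RH (phi (outer f f) h) h <= 8 * delta * NH h.
Proof.
have [g [g1 gx]] := shifted_large.
pose m := nmC (shifted *m g); pose f := m^-1%:C%C *: (shifted *m g).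
have m2 : 2^-1 <= m by rewrite ge_nm ?invr_ge0.
have m0 : 0 < m by apply: lt_le_trans m2; rewrite invr_gt0.
exists f; split.
  by apply: nsq_scale_unit; rewrite -nm_sqr -/m expf_neq0 // gt_eqF.
have xm u : 0 <= RC ((shifted - m%:C%C *: outer f f) *m u) u.
  pose w := cdot u (shifted *m g); pose t := m^-1%:C%C * w.
  have uf : cdot u f = t by rewrite /f (dotZr (@cdot R n)) conj_realC.
  rewrite mulmxBl -scalemxAl outer_mulmx rdotBl rdotZl.
  have -> : RC (cdot u f *: f) u = m ^- 2 * csq w.
    rewrite /rdot (dotZl (@cdot R n)) (dotC _ f u) mulC_conj /= -/(cdot u f) uf.
    by rewrite csqM csq_real exprVn.
  have := shifted_ge0 (u - t *: g).
  rewrite mulmxBr -scalemxAr rdotBl !rdotBr.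
  have -> : RC (shifted *m u) (t *: g) = m^-1 * csq w.
    rewrite /rdot (dotZr (@cdot R n)) /= cdot_adjmx shifted_adj -/w /t rmorphM /= conj_realC.
    by rewrite -mulrA [w^* * w]mulrC mulC_conj -realCM.
  have -> : RC (t *: (shifted *m g)) u = m^-1 * csq w.
    rewrite /rdot (dotZl (@cdot R n)) /= -/w (dotC (@cdot R n)) -/w.
    by rewrite -mulrA mulC_conj -realCM.
  have -> : RC (t *: (shifted *m g)) (t *: g) = m ^- 2 * csq w * RC (shifted *m g) g.
    rewrite /rdot (dotZl (@cdot R n)) (dotZr (@cdot R n)) mulrA mulC_conj Re_realM.
    by rewrite csqM csq_real exprVn.
  have gm : RC (shifted *m g) g <= m.
    have := rdot_le_nm (@cdot R n) (shifted *m g) g; rewrite -/m.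
    by rewrite [nmC g]/dot_norm -/(rdot _ _ _) -/(nsq _ _) g1 sqrtr1 mulr1.
  have w0 : 0 <= m ^- 2 * csq w by rewrite mulr_ge0 ?csq_ge0 ?invr_ge0 ?sqr_ge0.
  have := ler_wpM2l w0 gm.
  have -> : m ^- 2 * csq w * m = m^-1 * csq w by field; rewrite gt_eqF.
  have -> : m * (m ^- 2 * csq w) = m^-1 * csq w by field; rewrite gt_eqF.
  by move=> ha hb; apply: le_trans hb _; rewrite lerBlDr lerDl subr_ge0.
move=> h he.
have : 0 <= RH (phi (shifted - m%:C%C *: outer f f) h) h.
  apply: cp_pos => //.
  by rewrite adjmxB shifted_adj adjmxZ conj_realC adjmx_outer.
rewrite opmapB opmapZ rdotBl rdotZl shifted_phi.
have h2 := rdot_le_nm (@hdot R H) (phi x h - hdot h e *: e) h.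
have h3 : nmH (phi x h - hdot h e *: e) * nmH h <= delta * NH h.
  by rewrite -[NH h]nm_sqr expr2 mulrA ler_wpM2r ?nm_ge0 ?nm_phi_x.
have {h2} := le_trans h2 h3; rewrite rdotBl rdot_proj he csq_real expr0n subr0.
have := ler_wpM2l (ltW delta_gt0) (phi1 h).
have := ler_wpM2r (rdot_outer_ge0 f h) m2.
have := delta_gt0; lra.
Qed.

End FindRankOne.

(** * The approximate intertwiner *)

Section Intertwiner.
Variables (R : realType) (n : nat) (H : hilbertType R).
Variable phi : {linear 'M[R[i]]_n -> 'B(H)}.
Hypothesis phi_cp : completely_positive phi.
Local Notation C := R[i].
Local Notation NH := (nsq (@hdot R H)).
Local Notation RH := (rdot (@hdot R H)).
Local Notation NC := (nsq (@cdot R n)).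
Local Notation nmH := (dot_norm (@hdot R H)).
Hypothesis phi1 : forall h, RH (phi 1%:M h) h <= NH h.
Variable s : R.
Hypothesis s_gt0 : 0 < s.
Hypothesis s_small : s <= 100^-1.
Hypothesis phi_inv : forall y (M : R), 0 <= M ->
  (forall h, NH (phi y h) <= M ^+ 2 * NH h) ->
  forall u, NC (y *m u) <= ((1 + s ^+ 2) * M) ^+ 2 * NC u.
Variables (e : H) (f : 'cV[C]_n).
Hypothesis e1 : NH e = 1.
Hypothesis f1 : NC f = 1.
Hypothesis phi_f : forall h, hdot h e = 0 ->
  RH (phi (outer f f) h) h <= 8 * s ^+ 2 * NH h.

(** When [phi (f f^* )] is close to the projection onto the line of [e], this
    map is close to an isometry intertwining [phi] and the identity. *)
Definition intertwiner (g : 'cV[C]_n) : H := phi (outer g f) e.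
Local Notation W := intertwiner.

Lemma intertwinerD g1 g2 : W (g1 + g2) = W g1 + W g2.
Proof. by rewrite /W outerDl opmapD. Qed.

Lemma intertwinerZ c g : W (c *: g) = c *: W g.
Proof. by rewrite /W outerZl opmapZ. Qed.

Lemma intertwiner_sum I (r : seq I) (P : pred I) (F : I -> 'cV[C]_n) :
  W (\sum_(i <- r | P i) F i) = \sum_(i <- r | P i) W (F i).
Proof.
apply: (big_morph W intertwinerD).
by have := intertwinerZ 0 0; rewrite !scale0r.
Qed.

Lemma phi_outer_rdot g h :
  RH (phi (adjmx (outer g f) *m outer g f) h) h = NC g * RH (phi (outer f f) h) h.
Proof.
by rewrite adjmx_outer outerM (dot_nsq (@cdot R n)) opmapZ rdotZl.
Qed.

Lemma phi_outer_le1 h : RH (phi (outer f f) h) h <= NH h.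
Proof.
have : NH (phi (outer f f) h) <= 1 ^+ 2 * NH h.
  apply: cp_contractive1 => // u; rewrite outer_mulmx nsqZ f1 mulr1 expr1n mul1r.
  exact: csq_dot_unit.
by rewrite expr1n mul1r; have := rdot_le_nsq (@hdot R H) (phi (outer f f) h) h; lra.
Qed.

Lemma intertwiner_le g : NH (W g) <= NC g.
Proof.
apply: le_trans (cp_schwarz1 phi_cp phi1 _ _) _; rewrite phi_outer_rdot.
by rewrite -[leRHS]mulr1 ler_wpM2l ?nsq_ge0 // -e1 phi_outer_le1.
Qed.

Lemma hdot_perp h : hdot (h - hdot h e *: e) e = 0.
Proof.
by rewrite (dotBl (@hdot R H)) (dotZl (@hdot R H)) (dot_nsq (@hdot R H)) e1 mulr1 subrr.
Qed.

Lemma nsq_perp h : NH h = csq (hdot h e) + NH (h - hdot h e *: e).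
Proof.
rewrite nsqB nsqZ e1 mulr1 /rdot dotZr [_^* * _]mulrC mulC_conj /=; lra.
Qed.

Lemma phi_perp g h : NC g = 1 ->
  NH (phi (outer g f) (h - hdot h e *: e)) <= 8 * s ^+ 2 * NH h.
Proof.
move=> g1; apply: le_trans (cp_schwarz1 phi_cp phi1 _ _) _.
rewrite phi_outer_rdot g1 mul1r; apply: le_trans (phi_f (hdot_perp h)) _.
rewrite ler_wpM2l //; first by rewrite mulr_ge0 // sqr_ge0.
by rewrite [leRHS]nsq_perp lerDr csq_ge0.
Qed.

Lemma phi_split g h :
  phi (outer g f) h = hdot h e *: W g + phi (outer g f) (h - hdot h e *: e).
Proof. by rewrite bopBr bopZr addrC subrK. Qed.

(** The matrix [g f^*] has norm one, hence so has its image up to [1 + s^2];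
    that image almost vanishes on the orthogonal of [e], so that it must be
    large at [e]. *)
Lemma intertwiner_ge g : NC g = 1 -> 1 - 4 * s <= nmH (W g).
Proof.
move=> g1; pose M := nmH (W g) + 3 * s.
have s0 := s_gt0; have sle := s_small.
have w0 : 0 <= nmH (W g) by exact: nm_ge0.
have M0 : 0 <= M by rewrite /M; lra.
have phiM h : NH (phi (outer g f) h) <= M ^+ 2 * NH h.
  rewrite -[NH h]nm_sqr -exprMn -nm_le ?mulr_ge0 ?nm_ge0 //.
  rewrite phi_split; apply: le_trans (nmD _ _ _) _; rewrite /M mulrDl lerD //.
    rewrite nmZ mulrC ler_wpM2l ?nm_ge0 // ler_wsqrtr // -/(nsq _ _).
    have := nsq_perp h.
    by have := nsq_ge0 (@hdot R H) (h - hdot h e *: e); rewrite /nsq /rdot; lra.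
  rewrite nm_le ?mulr_ge0 ?nm_ge0 ?(ltW s0) // exprMn nm_sqr.
  apply: le_trans (phi_perp h g1) _; rewrite ler_wpM2r ?nsq_ge0 //.
  by rewrite exprMn ler_wpM2r ?sqr_ge0 //; lra.
have := phi_inv M0 phiM f.
rewrite outer_mulmx (dot_nsq (@cdot R n)) f1 scale1r g1 mulr1.
have s2 : 0 <= s ^+ 2 by rewrite sqr_ge0.
rewrite -[X in X <= _](expr1n _ 2) ler_sqr ?nnegrE ?mulr_ge0 //; last by lra.
rewrite /M; move: (nmH (W g)) w0 => w w0 h1.
have : s ^+ 2 <= 100^-1 * s by rewrite expr2 ler_wpM2r // ltW.
have [w1|w1] := lerP 1 w; first by lra.
have : s ^+ 2 * w <= s ^+ 2 by rewrite ler_piMr // ltW.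
have : s ^+ 2 * s <= s ^+ 2 * 100^-1 by rewrite ler_wpM2l.
move: h1; rewrite mulrDl mul1r mulrDr [s ^+ 2 * (3 * s)]mulrCA; lra.
Qed.

Lemma intertwiner_nsq_ge u : (1 - 8 * s) * NC u <= NH (W u).
Proof.
have [u0|u0] := eqVneq (NC u) 0.
  by rewrite u0 mulr0 nsq_ge0.
have := intertwiner_ge (nsq_scale_unit u0).
have s0 := s_gt0; have sle := s_small.
rewrite ge_nm; last by lra.
rewrite intertwinerZ nsqZ csq_real exprVn nm_sqr.
rewrite ler_pdivlMl ?lt_def ?u0 ?nsq_ge0 // mulrC => /(le_trans _); apply.
rewrite ler_wpM2r ?nsq_ge0 //.
have : 0 <= s ^+ 2 by rewrite sqr_ge0.
by have -> : (1 - 4 * s) ^+ 2 = 1 - 8 * s + 16 * s ^+ 2 by [ring]; lra.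
Qed.

Lemma phi_rank1_close h :
  NH (phi (outer f f) h - hdot h e *: e) <= 32 * s * NH h.
Proof.
have s0 := s_gt0; have sle := s_small.
have We : NH (W f - e) <= 8 * s.
  have h1 := cp_schwarz1 phi_cp phi1 (outer f f) e.
  have := intertwiner_nsq_ge f; rewrite f1 mulr1 => h2.
  move: h1; rewrite phi_outer_rdot f1 mul1r nsqB e1 -/(W f); lra.
rewrite phi_split addrAC -scalerBr.
apply: le_trans (nsqD_le _ _ _) _; rewrite nsqZ.
have h1 := phi_perp h f1.
have h2 : csq (hdot h e) * NH (W f - e) <= NH h * (8 * s).
  rewrite ler_pM ?csq_ge0 ?nsq_ge0 //.
  by rewrite [leRHS]nsq_perp lerDl nsq_ge0.
have : s ^+ 2 * NH h <= s * NH h.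
  rewrite ler_wpM2r ?nsq_ge0 // expr2 -[leRHS]mulr1 ler_wpM2l ?(ltW s0) //; lra.
move: h1 h2; rewrite -!mulrA [NH h * _]mulrCA [NH h * s]mulrC; lra.
Qed.

(** [phi (a) W] is close to [W a], uniformly over block contractions [a]. *)
Lemma intertwiner_mul k (a : 'I_k -> 'I_k -> 'M[C]_n) (u : 'I_k -> 'cV[C]_n) :
  (forall v : 'I_k -> 'cV[C]_n,
     \sum_l NC (\sum_j adjmx (a j l) *m v j) <= \sum_i NC (v i)) ->
  \sum_i NH (\sum_j phi (a i j) (W (u j)) - W (\sum_j a i j *m u j)) <=
  8 * s * \sum_i NC (u i).
Proof.
move=> a1.
have := cp_mul_defect phi_cp phi1 (fun l => outer (u l) f) e a1.
have -> : \sum_i NH (\sum_l (phi (a i l) (phi (outer (u l) f) e) -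
      phi (a i l *m outer (u l) f) e)) =
   \sum_i NH (\sum_j phi (a i j) (W (u j)) - W (\sum_j a i j *m u j)).
  apply: eq_bigr => i _; congr (NH _); rewrite intertwiner_sum -sumrB.
  by apply: eq_bigr => j _; rewrite mulmx_outer.
move/le_trans; apply; rewrite mulr_sumr; apply: ler_sum => l _.
rewrite phi_outer_rdot -/(W _).
have := ler_wpM2l (nsq_ge0 (@cdot R n) (u l)) (phi_outer_le1 e).
have := intertwiner_nsq_ge (u l); rewrite e1; lra.
Qed.

End Intertwiner.

(** * Bounded operators on a Hilbert space *)

Section BoundedOpConstructions.
Variables (R : realType) (H : hilbertType R).
Local Notation C := R[i].
Local Notation nmH := (dot_norm (@hdot R H)).

Lemma hilbert_normE (h : H) : `|h| = (nmH h)%:C%C.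
Proof.
apply/eqP; rewrite -(@eqrXn2 _ 2) ?normr_ge0 ?ler0c ?nm_ge0 //.
by rewrite hdotE (dot_nsq (@hdot R H)) expr2 -realCM -expr2 nm_sqr.
Qed.

Lemma bounded_op_bound (T : {linear H -> H}) (M : R) :
  (forall h, nmH (T h) <= M * nmH h) -> (T : H -> H) \in @bounded_op R H.
Proof.
move=> TM; apply/bounded_opP; split; first exact: linearP.
apply: bounded_linear_continuous; apply/linear_boundedP.
near=> r => h; rewrite !hilbert_normE.
have rM : M%:C%C <= r by near: r; apply: nbhs_pinfty_ge; apply/complex_realP; exists M.
apply: le_trans (_ : M%:C%C * (nmH h)%:C%C <= _); first by rewrite -realCM lecR.
by rewrite ler_wpM2r // ler0c nm_ge0.
Unshelve. all: by end_near.
Qed.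

Section Ket.
Variables b c : H.

(** The rank one operator [h |-> <h, b> c]. *)
Definition ket_fun (h : H) : H := hdot h b *: c.

Lemma ket_linear : linear ket_fun.
Proof.
by move=> k u v; rewrite /ket_fun (linearPl (hdot)) /= scalerDl scalerA.
Qed.

HB.instance Definition _ := GRing.isLinear.Build C H H _ ket_fun ket_linear.

Lemma ket_bounded : ket_fun \in @bounded_op R H.
Proof.
apply: (@bounded_op_bound ket_fun (nmH b * nmH c)) => h.
rewrite /ket_fun nmZ mulrAC ler_wpM2r ?nm_ge0 //.
rewrite -[leRHS]ger0_norm ?mulr_ge0 ?nm_ge0 // -sqrtr_sqr ler_wsqrtr //.
by rewrite exprMn !nm_sqr mulrC csq_dot_le.
Qed.

Definition ket : 'B(H) := BoundedOp ket_bounded.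

End Ket.

Lemma id_bounded : (id : H -> H) \in @bounded_op R H.
Proof. by apply/bounded_opP; split=> // h; exact: cvg_id. Qed.

Definition bop_id : 'B(H) := BoundedOp id_bounded.

Lemma comp_bounded (S T : 'B(H)) : (S \o T : H -> H) \in @bounded_op R H.
Proof.
have /bounded_opP[_ Sc] := boundedOpP S; have /bounded_opP[_ Tc] := boundedOpP T.
apply/bounded_opP; split=> [k u v|h] /=; first by rewrite !(bopDr, bopZr).
by apply: continuous_comp; [exact: Tc|exact: Sc].
Qed.

Definition bop_comp (S T : 'B(H)) : 'B(H) := BoundedOp (comp_bounded S T).

End BoundedOpConstructions.

(** * The complete order embedding attached to an orthonormal family *)

Section BlockAdjoint.
Variables (R : realType) (n k : nat).
Local Notation C := R[i].
Local Notation NC := (nsq (@cdot R n)).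
Local Notation RC := (rdot (@cdot R n)).

Lemma block_adj_contr (a : 'I_k -> 'I_k -> 'M[C]_n) :
  (forall v, \sum_l NC (\sum_j a l j *m v j) <= \sum_i NC (v i)) ->
  forall v, \sum_l NC (\sum_j adjmx (a j l) *m v j) <= \sum_i NC (v i).
Proof.
move=> a1 v; pose w l := \sum_j adjmx (a j l) *m v j.
have : 2 * \sum_l NC (w l) <= \sum_l NC (v l) + \sum_l NC (\sum_j a l j *m w j).
  have -> : \sum_l NC (w l) = \sum_j RC (v j) (\sum_l a j l *m w l).
    transitivity (\sum_l \sum_j RC (adjmx (a j l) *m v j) (w l)).
      by apply: eq_bigr => l _; rewrite -rdot_suml.
    rewrite exchange_big; apply: eq_bigr => j _ /=; rewrite rdot_sumr.
    by apply: eq_bigr => l _; rewrite rdot_adjmx adjmxK.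
  by rewrite mulr_sumr -big_split; apply: ler_sum => l _; exact: rdot_le_nsq.
have := a1 w; rewrite -/(w _); lra.
Qed.

End BlockAdjoint.

Section Embedding.
Variables (R : realType) (n : nat) (H : hilbertType R).
Local Notation C := R[i].
Local Notation NH := (nsq (@hdot R H)).
Local Notation RH := (rdot (@hdot R H)).
Local Notation NC := (nsq (@cdot R n)).
Local Notation RC := (rdot (@cdot R n)).
Variables (b : 'I_n -> H) (phi : {linear 'M[C]_n -> 'B(H)}).

(** The isometry of [C^n] into [H] given by the orthonormal family [b], its
    adjoint, and the projection onto the orthogonal of its range. *)
Definition iso (v : 'cV[C]_n) : H := \sum_i v i 0 *: b i.
Definition coiso (h : H) : 'cV[C]_n := \col_i hdot h (b i).
Definition perp : 'B(H) := bop_id H - \sum_i ket (b i) (b i).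

(** The embedding [a |-> U a U^* + (1 - U U^* ) phi a (1 - U U^* )], where [U] is
    the isometry above. *)
Definition embed (a : 'M[C]_n) : 'B(H) :=
  \sum_i \sum_j a i j *: ket (b j) (b i) + bop_comp perp (bop_comp (phi a) perp).

#[local] Arguments perp : simpl never.
#[local] Arguments embed : simpl never.

Lemma isoD u v : iso (u + v) = iso u + iso v.
Proof.
by rewrite /iso -big_split; apply: eq_bigr => i _; rewrite mxE scalerDl.
Qed.

Lemma isoZ c u : iso (c *: u) = c *: iso u.
Proof.
by rewrite /iso scaler_sumr; apply: eq_bigr => i _; rewrite mxE scalerA.
Qed.

Lemma iso_sum I (r : seq I) (P : pred I) (F : I -> 'cV[C]_n) :
  iso (\sum_(i <- r | P i) F i) = \sum_(i <- r | P i) iso (F i).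
Proof.
by apply: (big_morph iso isoD); rewrite -(scale0r 0) isoZ scale0r.
Qed.

Lemma hdot_iso v h : hdot (iso v) h = cdot v (coiso h).
Proof.
rewrite /iso (dot_suml (@hdot R H)) /cdot; apply: eq_bigr => i _.
by rewrite (dotZl (@hdot R H)) mxE -(dotC (@hdot R H)).
Qed.

Lemma rdot_iso v h : RH (iso v) h = RC v (coiso h).
Proof. by rewrite /rdot /= hdot_iso. Qed.

Lemma perpE h : perp h = h - iso (coiso h).
Proof.
rewrite bopB bop_sum /iso; congr (_ - _); apply: eq_bigr => i _.
by rewrite mxE.
Qed.

Lemma embedE a h : embed a h = iso (a *m coiso h) + perp (phi a (perp h)).
Proof.
rewrite bopD bop_sum; congr (_ + _); apply: eq_bigr => i _.
rewrite bop_sum mxE scaler_suml; apply: eq_bigr => j _.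
by rewrite -[LHS]/(a i j *: (hdot h (b j) *: b i)) mxE scalerA.
Qed.

Lemma embed_linear : linear embed.
Proof.
move=> c a a'; apply: bop_ext => h.
rewrite -[RHS]/(c *: embed a h + embed a' h) !embedE opmapD opmapZ mulmxDl -scalemxAl isoD isoZ.
by rewrite bopDr bopZr [c *: (iso _ + _)]scalerDr addrACA.
Qed.

HB.instance Definition _ :=
  GRing.isLinear.Build C 'M[C]_n 'B(H) _ embed embed_linear.

Hypothesis orthonormal_b : forall i j, hdot (b i) (b j) = (i == j)%:R.

Lemma isoK v : coiso (iso v) = v.
Proof.
apply/colP => i; rewrite mxE /iso (dot_suml (@hdot R H)) (bigD1 i) //=.
rewrite (dotZl (@hdot R H)) orthonormal_b eqxx mulr1 big1 ?addr0 // => j ji.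
by rewrite (dotZl (@hdot R H)) orthonormal_b (negPf ji) mulr0.
Qed.

Lemma coisoB h k : coiso (h - k) = coiso h - coiso k.
Proof. by apply/colP => i; rewrite !mxE (dotBl (@hdot R H)). Qed.

Lemma nsq_iso v : NH (iso v) = NC v.
Proof. by rewrite /nsq rdot_iso isoK. Qed.

Lemma coiso_perp h : coiso (perp h) = 0.
Proof. by rewrite perpE coisoB isoK subrr. Qed.

Lemma hdot_iso_perp v h : hdot (iso v) (perp h) = 0.
Proof. by rewrite hdot_iso coiso_perp (linear0r (@cdot R n)). Qed.

Lemma perp_sym h k : hdot (perp h) k = hdot h (perp k).
Proof.
have Ek (x : H) : x = perp x + iso (coiso x) by rewrite perpE subrK.
have P0 x v : hdot (perp x) (iso v) = 0.
  by rewrite (dotC (@hdot R H)) hdot_iso_perp rmorph0.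
transitivity (hdot (perp h) (perp k)).
  by rewrite [in LHS](Ek k) (dotDr (@hdot R H)) P0 addr0.
by rewrite [in RHS](Ek h) (dotDl _ (perp h) (iso (coiso h))) hdot_iso_perp addr0.
Qed.

Lemma nsq_iso_perp v h : NH (iso v + perp h) = NC v + NH (perp h).
Proof.
by rewrite nsqD nsq_iso /rdot /= hdot_iso_perp /= mulr0 addr0.
Qed.

Lemma nsq_split h : NH h = NC (coiso h) + NH (perp h).
Proof. by rewrite -nsq_iso_perp perpE addrC subrK. Qed.

Lemma nsq_embed k (X : 'I_k -> 'I_k -> 'M[C]_n) (h : 'I_k -> H) i :
  NH (\sum_j embed (X i j) (h j)) =
  NC (\sum_j X i j *m coiso (h j)) +
  NH (perp (\sum_j phi (X i j) (perp (h j)))).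
Proof.
rewrite -nsq_iso_perp iso_sum bopr_sum -big_split.
by congr (NH _); apply: eq_bigr => j _; rewrite embedE.
Qed.

Hypothesis phi_cp : completely_positive phi.
Hypothesis phi1 : forall h, RH (phi 1%:M h) h <= NH h.

Lemma embed_cp : completely_positive embed.
Proof.
move=> k X X0 h; rewrite /amp_dot.
have -> : \sum_i os_dot (amp_act (map_mx embed X) h i) (h i) =
  \sum_i \sum_j cdot (X i j *m coiso (h j)) (coiso (h i)) +
  \sum_i \sum_j hdot (phi (X i j) (perp (h j))) (perp (h i)).
  rewrite -big_split; apply: eq_bigr => i _; rewrite -big_split /=.
  rewrite (linear_sumlz (@hdot R H)); apply: eq_bigr => j _.
  by rewrite mxE [LHS](congr1 (hdot^~ _) (embedE _ _)) (dotDl (@hdot R H)) hdot_iso perp_sym.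
rewrite addr_ge0 //.
  have := X0 (fun i => coiso (h i)); congr (0 <= _).
  by rewrite /amp_dot; apply: eq_bigr => i _; rewrite (linear_sumlz (@cdot R n)).
have := phi_cp X0 (fun i => perp (h i)); congr (0 <= _).
rewrite /amp_dot; apply: eq_bigr => i _; rewrite (linear_sumlz (@hdot R H)).
by apply: eq_bigr => j _; rewrite mxE.
Qed.

Lemma embed_isometric : completely_isometric embed.
Proof.
move=> k X; apply/eqP; rewrite eq_le; apply/andP; split; apply: amp_norm_le => M M0.
  move=> /(amp_normP _ M0) XM; apply/(amp_normP _ M0) => h.
  have -> : \sum_i nsq os_dot (\sum_j os_act (map_mx embed X i j) (h j)) =
      \sum_i NH (\sum_j embed (X i j) (h j)).
    by apply: eq_bigr => i _; congr (NH _); apply: eq_bigr => j _; rewrite mxE.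
  under eq_bigr => i _ do rewrite nsq_embed.
  have -> : \sum_i nsq os_dot (h i) = \sum_i NC (coiso (h i)) + \sum_i NH (perp (h i)).
    by rewrite -big_split; apply: eq_bigr => i _; exact: nsq_split.
  rewrite big_split mulrDr lerD //; first exact: XM.
  have := cp_contractive phi_cp phi1 (X := fun i j => X i j) (fun i => perp (h i)) XM.
  apply: le_trans; apply: ler_sum => i _.
  by rewrite [leRHS]nsq_split lerDr nsq_ge0.
move=> /(amp_normP _ M0) XM; apply/(amp_normP _ M0) => u.
have isou : \sum_i NH (iso (u i)) = \sum_i NC (u i).
  by apply: eq_bigr => i _; exact: nsq_iso.
apply: le_trans (le_trans (XM (fun i => iso (u i))) _); last first.
  by rewrite -[leLHS]/(M ^+ 2 * \sum_i NH (iso (u i))) isou.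
apply: ler_sum => i _.
apply: le_trans (_ : NH (\sum_j embed (X i j) (iso (u j))) <= _); last first.
  rewrite le_eqVlt; apply/orP; left; apply/eqP; congr (NH _).
  by apply: eq_bigr => j _; rewrite mxE.
rewrite (nsq_embed (fun i j => X i j)).
under [X in _ <= NC X + _]eq_bigr => j _ do rewrite isoK.
by rewrite lerDl nsq_ge0.
Qed.

Lemma embed_order_embedding : complete_order_embedding embed.
Proof. by split; [exact: embed_cp|exact: embed_isometric]. Qed.

(** If [phi (a) U] is close to [U a], then so is [U^* phi (a)] to [a U^*], by
    taking adjoints, and [embed] is close to [phi]. *)
Lemma embed_close (c : R) k (a : 'I_k -> 'I_k -> 'M[C]_n) (h : 'I_k -> H) :
  0 < c ->
  (forall (a' : 'I_k -> 'I_k -> 'M[C]_n) (u : 'I_k -> 'cV[C]_n),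
    (forall v, \sum_l NC (\sum_j a' l j *m v j) <= \sum_i NC (v i)) ->
    \sum_i NH (\sum_j phi (a' i j) (iso (u j)) - iso (\sum_j a' i j *m u j))
      <= c * \sum_i NC (u i)) ->
  (forall v, \sum_l NC (\sum_j a l j *m v j) <= \sum_i NC (v i)) ->
  \sum_i NH (\sum_j (embed (a i j) (h j) - phi (a i j) (h j)))
    <= 2 * c * \sum_i NH (h i).
Proof.
move=> c0 near a1.
pose d i := \sum_j phi (a i j) (iso (coiso (h j))) - iso (\sum_j a i j *m coiso (h j)).
(* the part of [phi a] leading from the orthogonal of the range of [U] into it *)
pose z i := coiso (\sum_j phi (a i j) (perp (h j))).
have split_i i : \sum_j (embed (a i j) (h j) - phi (a i j) (h j)) =
    - d i - iso (z i).
  have phi_h j : phi (a i j) (h j) =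
      phi (a i j) (perp (h j)) + phi (a i j) (iso (coiso (h j))).
    by rewrite -bopDr perpE subrK.
  have -> : iso (z i) = \sum_j phi (a i j) (perp (h j)) -
      perp (\sum_j phi (a i j) (perp (h j))).
    by rewrite [perp (\sum_j _)]perpE subKr.
  rewrite /d iso_sum bopr_sum !opprB sumrB.
  under eq_bigr => j _ do rewrite embedE.
  under [X in _ - X]eq_bigr => j _ do rewrite phi_h.
  by rewrite !big_split /= [X in _ - X]addrC opprD addrACA.
have d_le : \sum_i NH (d i) <= c * \sum_i NC (coiso (h i)) by apply: near.
have z_le : \sum_i NC (z i) <= c * \sum_i NH (perp (h i)).
  pose a' l j := adjmx (a j l).
  pose d' j := \sum_i phi (a' j i) (iso (z i)) - iso (\sum_i a' j i *m z i).
  have d'_le : \sum_j NH (d' j) <= c * \sum_i NC (z i).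
    by apply: near; exact: block_adj_contr.
  have zE : \sum_i NC (z i) = \sum_j RH (perp (h j)) (d' j).
    transitivity (\sum_i \sum_j RH (phi (a i j) (perp (h j))) (iso (z i))).
      by apply: eq_bigr => i _; rewrite -rdot_suml rdotC rdot_iso.
    rewrite exchange_big; apply: eq_bigr => j _ /=.
    rewrite /d' rdotBr rdot_sumr [X in _ = _ - X]rdotC.
    rewrite [X in _ = _ - X]/rdot /= hdot_iso_perp subr0.
    apply: eq_bigr => i _.
    by rewrite rdotC -cp_rdot_adj // rdotC.
  have amgm : 2 * \sum_j RH (perp (h j)) (d' j) <=
      c * \sum_j NH (perp (h j)) + c^-1 * \sum_j NH (d' j).
    rewrite !mulr_sumr -big_split; apply: ler_sum => j _ /=.
    exact: rdot_amgm.
  move: amgm; rewrite -zE.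
  have : c^-1 * \sum_j NH (d' j) <= \sum_i NC (z i) by rewrite ler_pdivrMl.
  lra.
under eq_bigr => i _ do rewrite split_i.
have : \sum_i NH (- d i - iso (z i)) <= 2 * \sum_i NH (d i) + 2 * \sum_i NC (z i).
  rewrite !mulr_sumr -big_split; apply: ler_sum => i _ /=.
  rewrite -opprD -nsq_iso (_ : NH (- _) = NH (d i + iso (z i))) ?nsqD_le //.
  by rewrite /nsq rdotNl rdotNr opprK.
have -> : \sum_i NH (h i) = \sum_i NC (coiso (h i)) + \sum_i NH (perp (h i)).
  by rewrite -big_split; apply: eq_bigr => i _; exact: nsq_split.
by move: d_le z_le; rewrite mulrDr -!mulrA; lra.
Qed.

End Embedding.

(** * Orthonormal families *)

Section Polar.
Variables (R : realType) (n : nat) (H : hilbertType R).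
Local Notation C := R[i].
Local Notation NH := (nsq (@hdot R H)).
Local Notation NC := (nsq (@cdot R n)).
Local Notation nmH := (dot_norm (@hdot R H)).

Lemma nsq_cdotE (v : 'cV[C]_n) : NC v = \sum_i csq (v i 0).
Proof.
rewrite /nsq /rdot /= /cdot raddf_sum /=.
by apply: eq_bigr => i _; rewrite mulC_conj.
Qed.

Lemma cdot_delta (u : 'cV[C]_n) j : cdot u (delta_mx j 0) = u j 0.
Proof.
rewrite /cdot (bigD1 j) //= mxE !eqxx rmorph1 mulr1 big1 ?addr0 // => i ij.
by rewrite mxE (negPf ij) rmorph0 mulr0.
Qed.

(** The spectral theorem for self-adjoint matrices. *)
Lemma selfadjoint_diag (G : 'M[C]_n) : adjmx G = G ->
  exists P : 'M[C]_n, [/\ P *m adjmx P = 1%:M, adjmx P *m P = 1%:M &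
    is_diag_mx (P *m G *m adjmx P)].
Proof.
move=> GG; have Gn : G \is normalmx by apply/normalmxP; rewrite -/(adjmx G) GG.
pose P := spectralmx G.
have PP : P *m adjmx P = 1%:M by apply/unitarymxP; exact: spectral_unitarymx.
have P'P := mulmx1C PP; exists P; split=> //.
have /orthomx_spectralP := Gn; rewrite -/P invmx_unitary ?spectral_unitarymx //.
rewrite -/(adjmx P) => ->; rewrite !mulmxA PP mul1mx -mulmxA PP mulmx1.
exact: diag_mx_is_diag.
Qed.

(** An almost isometric linear map is close to an isometry: diagonalise its
    Gram matrix and normalise the images of the eigenvectors, as in the polar
    decomposition. The bound does not depend on [n]. *)
Lemma near_isometry (W : 'cV[C]_n -> H) (eta : R) :
  (forall u v, W (u + v) = W u + W v) -> (forall c u, W (c *: u) = c *: W u) ->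
  eta < 1 ->
  (forall g, NC g = 1 -> 1 - eta <= nmH (W g) <= 1) ->
  exists b : 'I_n -> H, (forall i j, hdot (b i) (b j) = (i == j)%:R) /\
    forall u, NH (iso b u - W u) <= eta ^+ 2 * NC u.
Proof.
move=> WD WZ eta1 W1.
have W_sum (I : finType) (F : I -> 'cV[C]_n) : W (\sum_i F i) = \sum_i W (F i).
  by apply: (big_morph W WD); rewrite -(scale0r 0) WZ scale0r.
have WE v : W v = \sum_i v i 0 *: W (delta_mx i 0).
  rewrite {1}[v]matrix_sum_delta exchange_big big_ord1 W_sum.
  by apply: eq_bigr => i _; rewrite WZ.
pose G : 'M[C]_n := \matrix_(i, j) hdot (W (delta_mx j 0)) (W (delta_mx i 0)).
have GE u v : cdot (G *m u) v = hdot (W u) (W v).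
  rewrite (WE u) (dot_suml (@hdot R H)) (WE v) /cdot.
  under eq_bigr => i _ do rewrite mxE mulr_suml.
  rewrite exchange_big; apply: eq_bigr => j _ /=.
  rewrite (dotZl (@hdot R H)) (dot_sumr (@hdot R H)) mulr_sumr.
  apply: eq_bigr => i _; rewrite (dotZr (@hdot R H)) mxE; ring.
have GG : adjmx G = G.
  by apply/matrixP => i j; rewrite !mxE -(dotC (@hdot R H)).
have [P [PP P'P Pdiag]] := selfadjoint_diag GG.
pose g i : 'cV[C]_n := adjmx P *m delta_mx i 0.
have gg i j : cdot (g i) (g j) = (i == j)%:R.
  by rewrite /g cdot_adjmx adjmxK mulmxA PP mul1mx cdot_delta mxE eqxx andbT eq_sym.
have Wgg i j : i != j -> hdot (W (g i)) (W (g j)) = 0.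
  move=> ij; rewrite -GE {2}/g -[P]adjmxK -cdot_adjmx adjmxK.
  rewrite cdot_delta /g !mulmxA -colE mxE.
  by move/is_diag_mxP: Pdiag; apply; rewrite eq_sym.
have g1 i : NC (g i) = 1 by rewrite /nsq /rdot /= gg eqxx.
have m_gt0 i : 0 < nmH (W (g i)).
  by have /andP[+ _] := W1 _ (g1 i); apply: lt_le_trans; rewrite subr_gt0.
pose c i := (nmH (W (g i)))^-1%:C%C *: W (g i).
have cc i j : hdot (c i) (c j) = (i == j)%:R.
  rewrite /c (dotZl (@hdot R H)) (dotZr (@hdot R H)) conj_realC mulrA -realCM.
  have [<-|ij] := eqVneq i j; last by rewrite Wgg ?mulr0.
  rewrite (dot_nsq (@hdot R H)) -nm_sqr -realCM /= expr2.
  by rewrite mulrACA !mulVf ?mulr1 // gt_eqF.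
exists (fun k => iso c (P *m delta_mx k 0)); split.
  move=> i j; rewrite hdot_iso isoK // cdot_adjmx mulmxA P'P mul1mx.
  by rewrite cdot_delta mxE eqxx andbT eq_sym.
move=> u; pose v := P *m u.
have -> : iso (fun k => iso c (P *m delta_mx k 0)) u = iso c v.
  rewrite /v {2}[u]matrix_sum_delta exchange_big big_ord1 mulmx_sumr iso_sum.
  by apply: eq_bigr => i _; rewrite -scalemxAr isoZ.
pose w : 'cV[C]_n := \col_i ((1 - nmH (W (g i)))%:C%C * v i 0).
have -> : iso c v - W u = iso c w.
  have -> : W u = \sum_i v i 0 *: W (g i).
    have -> : u = adjmx P *m v by rewrite /v mulmxA P'P mul1mx.
    rewrite {1}[v]matrix_sum_delta exchange_big big_ord1 mulmx_sumr W_sum.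
    by apply: eq_bigr => i _; rewrite -scalemxAr WZ.
  rewrite /iso -sumrB; apply: eq_bigr => i _; rewrite [w i 0]mxE.
  have Wc : W (g i) = (nmH (W (g i)))%:C%C *: c i.
    by rewrite /c scalerA -realCM mulfV ?scale1r // gt_eqF.
  rewrite [X in _ - _ *: X]Wc [X in _ - X]scalerA -scalerBl realCB -[1%:C%C]/(1 : C).
  by rewrite mulrBl mul1r [v i 0 * _]mulrC.
rewrite nsq_iso //.
have -> : NC u = NC v.
  by rewrite /nsq /v rdot_adjmx mulmxA P'P mul1mx.
rewrite !nsq_cdotE mulr_sumr; apply: ler_sum => i _.
rewrite [w i 0]mxE csqM csq_real ler_wpM2r ?csq_ge0 //.
have /andP[h1 h2] := W1 _ (g1 i).
by rewrite ler_sqr ?nnegrE; lra.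
Qed.

End Polar.

Section Dimension.
Variables (R : realType) (H : hilbertType R).
Local Notation C := R[i].
Local Notation nmH := (dot_norm (@hdot R H)).

Lemma orthonormal_extend m (b : 'I_m -> H) (h : H) :
  (forall i j, hdot (b i) (b j) = (i == j)%:R) -> perp b h != 0 ->
  exists b' : 'I_m.+1 -> H, forall i j, hdot (b' i) (b' j) = (i == j)%:R.
Proof.
move=> bb h0; pose e := (nmH (perp b h))^-1%:C%C *: perp b h.
have be i : hdot (b i) e = 0.
  rewrite (dotZr (@hdot R H)) (dotC (@hdot R H)).
  have := congr1 (fun v : 'cV_m => v i 0) (coiso_perp bb h).
  by rewrite /coiso !mxE => ->; rewrite rmorph0 mulr0.
have ee : hdot e e = 1.
  have n0 : nmH (perp b h) != 0 by apply: contra_neq h0; exact: nm_eq0.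
  rewrite (dot_nsq (@hdot R H)) nsqZ csq_real -nm_sqr -exprMn mulVf //.
  by rewrite expr1n.
exists (fun i => if unlift ord_max i is Some j then b j else e) => i j.
case: unliftP => [i'|] ->; case: unliftP => [j'|] ->.
- by rewrite bb (inj_eq lift_inj).
- by rewrite be eq_sym (negPf (neq_lift _ _)).
- by rewrite (dotC (@hdot R H)) be rmorph0 (negPf (neq_lift _ _)).
- by rewrite ee eqxx.
Qed.

(** A linear map between matrix spaces that lowers the size has a kernel. *)
Lemma matrix_kernel n m (f : {linear 'M[C]_n -> 'M[C]_m}) : (m < n)%N ->
  exists2 a : 'M[C]_n, a != 0 & f a = 0.
Proof.
move=> mn; have : kermx (lin_mx f) != 0.
  rewrite kermx_eq0 /row_free neq_ltn (leq_ltn_trans (rank_leq_col _)) //.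
  by rewrite ltn_mul.
case/rowV0Pn => v /sub_kermxP vf v0; exists (vec_mx v).
  by apply: contra_neq v0 => v0; rewrite -[v]vec_mxK v0 linear0.
by have := mul_vec_lin f (vec_mx v); rewrite vec_mxK vf => /(congr1 vec_mx); rewrite mxvecK linear0.
Qed.

(** An injective linear map from [n]-by-[n] matrices to [B(H)] forces [H] to
    have dimension at least [n]. *)
Lemma orthonormal_exists n (phi : {linear 'M[C]_n -> 'B(H)}) m :
  injective phi -> (m <= n)%N ->
  exists b : 'I_m -> H, forall i j, hdot (b i) (b j) = (i == j)%:R.
Proof.
move=> phi_inj; elim: m => [|m IH] mn; first by exists (fun=> 0) => -[].
have [b bb] := IH (ltnW mn).
have [[h h0]|/forallNP noh] := pselect (exists h, perp b h != 0).
  exact: orthonormal_extend bb h0.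
have span h : h = iso b (coiso b h).
  have /negP := noh h; rewrite negbK perpE subr_eq0 => /eqP; exact.
pose f (a : 'M[C]_n) : 'M[C]_m := \matrix_(i, j) hdot (phi a (b j)) (b i).
have f_lin : linear f.
  move=> c a a'; apply/matrixP => i j.
  by rewrite !mxE opmapD opmapZ (dotDl (@hdot R H)) (dotZl (@hdot R H)).
pose fL : {linear 'M[C]_n -> 'M[C]_m} :=
  HB.pack f (GRing.isLinear.Build _ _ _ _ f f_lin).
have [a a0 fa] := matrix_kernel fL mn.
have ab j : phi a (b j) = 0.
  rewrite [LHS]span; have -> : coiso b (phi a (b j)) = 0.
    apply/colP => i; have := congr1 (fun A : 'M[C]_m => A i j) fa.
    by rewrite !mxE.
  by rewrite -(scale0r 0) isoZ scale0r.
case/negP: a0; apply/eqP/phi_inj/bop_ext => h.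
rewrite linear0 [h]span /iso bopr_sum big1 // => i _.
by rewrite bopZr ab scaler0.
Qed.

End Dimension.

(** * Stability of complete order embeddings *)

Section Bounds.
Variables (R : realType) (n : nat) (H : hilbertType R).
Local Notation C := R[i].
Local Notation NH := (nsq (@hdot R H)).
Local Notation RH := (rdot (@hdot R H)).
Local Notation NC := (nsq (@cdot R n)).

Lemma bop_normP (T : 'B(H)) (M : R) : 0 <= M ->
  (os_norm T <= M%:E)%E <-> forall h, NH (T h) <= M ^+ 2 * NH h.
Proof. by move=> M0; exact: (os_normP T M0). Qed.

Lemma contractive_le1 (phi : {linear 'M[C]_n -> 'B(H)}) :
  contractive phi -> forall h, RH (phi 1%:M h) h <= NH h.
Proof.
move=> phi_contr h.
have one1 : (os_norm (1%:M : 'M[C]_n) <= 1%:E)%E.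
  apply/os_normP => // v; rewrite expr1n mul1r.
  by have -> : os_act (1%:M : 'M[C]_n) v = v by exact: mul1mx.
have /(bop_normP _ ler01) := le_trans (phi_contr 1%:M) one1.
move=> /(_ h); rewrite expr1n mul1r.
have := rdot_le_nsq (@hdot R H) (phi 1%:M h) h; lra.
Qed.

(** The cb norm of [phi^-1] bounds its operator norm, by taking blocks of size
    one. *)
Lemma inverse_bound (phi : {linear 'M[C]_n -> 'B(H)}) (K : R) :
  injective phi -> 0 <= K ->
  (cb_norm (range phi) ('pinv_(fun=> 0%R) setT phi) <= K%:E)%E ->
  forall y (M : R), 0 <= M -> (forall h, NH (phi y h) <= M ^+ 2 * NH h) ->
  forall u, NC (y *m u) <= (K * M) ^+ 2 * NC u.
Proof.
move=> phi_inj K0 phi_inv y M M0 yM u.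
have [M_0|M_neq0] := eqVneq M 0.
  have -> : y = 0.
    apply: phi_inj; rewrite linear0; apply: bop_ext => h.
    apply: (@nsq_eq0 _ _ (@hdot R H)); apply: le_anti; rewrite nsq_ge0 andbT.
    by have := yM h; rewrite M_0 expr0n mul0r.
  by rewrite mul0mx nsq0 mulr_ge0 ?sqr_ge0 ?nsq_ge0.
have Mp : 0 < M by rewrite lt_def M_neq0.
pose y1 := M^-1%:C%C *: y; pose X : 'M['B(H)]_1 := const_mx (phi y1).
have pinv_phi a : 'pinv_(fun=> 0) setT phi (phi a) = a.
  by apply: pinvKV => //; [move=> ? ? _ _; exact: phi_inj|exact: in_setT].
have X1 : (amp_norm X <= 1%:E)%E.
  apply/amp_normP => // h; rewrite !big_ord1 mxE expr1n mul1r.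
  rewrite [leLHS](_ : _ = NH (phi y1 (h 0))) // opmapZ nsqZ csq_real exprVn.
  by rewrite ler_pdivrMl ?exprn_gt0 // yM.
have : (amp_norm (map_mx ('pinv_(fun=> 0%R) setT phi) X) <= K%:E)%E.
  apply: le_trans phi_inv; apply: ereal_sup_ubound; exists 1%N, X; split=> //.
  by move=> i j; rewrite mxE; exists y1.
move=> /(amp_normP _ K0) /(_ (fun=> u)); rewrite !big_ord1 !mxE pinv_phi => y1u.
have : NC (y1 *m u) <= K ^+ 2 * NC u by exact: y1u.
rewrite /y1 -scalemxAl nsqZ csq_real exprVn ler_pdivrMl ?exprn_gt0 //.
by rewrite exprMn mulrA [M ^+ 2 * _]mulrC.
Qed.

(** The cb norm of a difference of maps into [B(H)]. *)
Lemma cb_norm_sub_le (psi phi : {linear 'M[C]_n -> 'B(H)}) (K M : R) :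
  0 <= M -> K <= M ^+ 2 ->
  (forall k (a : 'I_k -> 'I_k -> 'M[C]_n) (h : 'I_k -> H),
    (forall v, \sum_l NC (\sum_j a l j *m v j) <= \sum_i NC (v i)) ->
    \sum_i NH (\sum_j (psi (a i j) (h j) - phi (a i j) (h j)))
      <= K * \sum_i NH (h i)) ->
  (cb_norm setT (psi \- phi)%R <= M%:E)%E.
Proof.
move=> M0 KM bound; apply: ge_ereal_sup => _ [k [X [_ X1 ->]]].
apply/amp_normP => // h.
have a1 v : \sum_l NC (\sum_j X l j *m v j) <= \sum_i NC (v i).
  by have /(amp_normP _ ler01) := X1; move=> /(_ v); rewrite expr1n mul1r; exact.
have := bound k (fun i j => X i j) h a1.
have -> : \sum_i nsq os_dot (\sum_j os_act (map_mx (psi \- phi) X i j) (h j)) =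
    \sum_i NH (\sum_j (psi (X i j) (h j) - phi (X i j) (h j))).
  apply: eq_bigr => i _; congr (NH _); apply: eq_bigr => j _.
  by rewrite mxE.
move/le_trans; apply; rewrite [leLHS]mulrC [leRHS]mulrC ler_wpM2l //.
by rewrite sumr_ge0 // => i _; exact: nsq_ge0.
Qed.

End Bounds.

Section Main.
Variables (R : realType) (n : nat) (H : hilbertType R).
Variable phi : {linear 'M[R[i]]_n -> 'B(H)}.
Local Notation C := R[i].
Local Notation NH := (nsq (@hdot R H)).
Local Notation RH := (rdot (@hdot R H)).
Local Notation NC := (nsq (@cdot R n)).
Hypothesis phi_cp : completely_positive phi.
Hypothesis phi1 : forall h, RH (phi 1%:M h) h <= NH h.

(** The regime of small [delta], with [s] its square root. *)
Section Small.
Variable s : R.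
Hypothesis s_gt0 : 0 < s.
Hypothesis s_small : s <= 100^-1.
Hypothesis phi_inv : forall y (M : R), 0 <= M ->
  (forall h, NH (phi y h) <= M ^+ 2 * NH h) ->
  forall u, NC (y *m u) <= ((1 + s ^+ 2) * M) ^+ 2 * NC u.
Variables (e : H) (p : 'B(H)) (x : 'M[C]_n).
Hypothesis e1 : NH e = 1.
Hypothesis pE : forall h, p h = hdot h e *: e.
Hypothesis phi_x : forall h, NH (phi x h - hdot h e *: e) <= (s ^+ 2) ^+ 2 * NH h.

Lemma exists_rank1 : exists f : 'cV[C]_n, NC f = 1 /\
  forall h, hdot h e = 0 -> RH (phi (outer f f) h) h <= 8 * s ^+ 2 * NH h.
Proof.
have s0 := s_gt0; have sle := s_small.
apply: (@rank1_dominated _ _ _ _ phi_cp phi1 (s ^+ 2) _ _ phi_inv e p x) => //.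
  by rewrite exprn_gt0.
have : s ^+ 2 <= s by rewrite expr2 ler_piMr ?(ltW s0) //; lra.
lra.
Qed.

Lemma close_projection : exists r : 'M[C]_n, rank1_projection_mx r /\
  forall h, NH (phi r h - p h) <= 32 * s * NH h.
Proof.
have [f [f1 phi_f]] := exists_rank1.
exists (outer f f); split; first exact: rank1_outer.
move=> h; rewrite pE.
exact: (phi_rank1_close phi_cp phi1 s_gt0 s_small phi_inv e1 f1 phi_f).
Qed.

Lemma close_embedding : exists b : 'I_n -> H,
  (forall i j, hdot (b i) (b j) = (i == j)%:R) /\
  forall k (a : 'I_k -> 'I_k -> 'M[C]_n) (h : 'I_k -> H),
    (forall v, \sum_l NC (\sum_j a l j *m v j) <= \sum_i NC (v i)) ->
    \sum_i NH (\sum_j (embed b phi (a i j) (h j) - phi (a i j) (h j)))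
      <= 36 * s * \sum_i NH (h i).
Proof.
have s0 := s_gt0; have sle := s_small.
have [f [f1 phi_f]] := exists_rank1.
pose W := intertwiner phi e f.
have [b [bb bW]] : exists b : 'I_n -> H, (forall i j, hdot (b i) (b j) = (i == j)%:R) /\
    forall u, NH (iso b u - W u) <= (4 * s) ^+ 2 * NC u.
  apply: near_isometry; first exact: intertwinerD; first exact: intertwinerZ.
    lra.
  move=> g g1; rewrite (intertwiner_ge phi_cp phi1 s0 sle phi_inv e1 f1 phi_f g1) /=.
  by rewrite nm_le // expr1n -g1; exact: intertwiner_le.
exists b; split=> // k a h a1.
have -> : 36 * s = 2 * (18 * s) by ring.
apply: embed_close => //; first by rewrite mulr_gt0.
move=> {}a u {}a1.
have arith (t A B D E u' : R) : t <= 2 * A + 4 * B + 4 * D -> A <= 8 * s * u' ->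
    B <= E -> E <= 16 * s ^+ 2 * u' -> D <= 16 * s ^+ 2 * u' ->
    0 <= s * u' -> s ^+ 2 * u' <= 100^-1 * (s * u') -> t <= 18 * s * u'.
  lra.
pose E v := iso b v - W v.
have isoE v : iso b v = W v + E v by rewrite /E addrC subrK.
pose A i := \sum_j phi (a i j) (W (u j)) - W (\sum_j a i j *m u j).
pose B i := \sum_j phi (a i j) (E (u j)).
pose D i := E (\sum_j a i j *m u j).
have -> : \sum_i NH (\sum_j phi (a i j) (iso b (u j)) - iso b (\sum_j a i j *m u j)) =
    \sum_i NH (A i + (B i - D i)).
  apply: eq_bigr => i _; congr (NH _); rewrite isoE.
  under eq_bigr => j _ do rewrite isoE bopDr.
  by rewrite big_split opprD addrACA.
have A_le : \sum_i NH (A i) <= 8 * s * \sum_i NC (u i).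
  exact: (intertwiner_mul phi_cp phi1 s0 sle phi_inv e1 f1 phi_f u (block_adj_contr a1)).
have B_le : \sum_i NH (B i) <= \sum_i NH (E (u i)).
  have := @cp_contractive _ _ _ _ phi_cp phi1 _ a 1 (fun i => E (u i)).
  by rewrite expr1n mul1r; apply=> v; rewrite mul1r; exact: a1.
have E_le : \sum_i NH (E (u i)) <= 16 * s ^+ 2 * \sum_i NC (u i).
  rewrite mulr_sumr; apply: ler_sum => i _; apply: le_trans (bW _) _.
  by rewrite exprMn -natrX.
have D_le : \sum_i NH (D i) <= 16 * s ^+ 2 * \sum_i NC (u i).
  apply: le_trans (_ : 16 * s ^+ 2 * \sum_i NC (\sum_j a i j *m u j) <= _).
    rewrite mulr_sumr; apply: ler_sum => i _; apply: le_trans (bW _) _.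
    by rewrite exprMn -natrX.
  by rewrite ler_wpM2l // mulr_ge0 // sqr_ge0.
have sum_le : \sum_i NH (A i + (B i - D i)) <=
    2 * \sum_i NH (A i) + 4 * \sum_i NH (B i) + 4 * \sum_i NH (D i).
  rewrite !mulr_sumr -!big_split; apply: ler_sum => i _ /=.
  have := nsqD_le (@hdot R H) (A i) (B i - D i).
  have := nsqB_le (@hdot R H) (B i) (D i); lra.
have u0 : 0 <= \sum_i NC (u i) by rewrite sumr_ge0 // => i _; exact: nsq_ge0.
have su0 : 0 <= s * \sum_i NC (u i) by rewrite mulr_ge0 // ltW.
have s2u : s ^+ 2 * \sum_i NC (u i) <= 100^-1 * (s * \sum_i NC (u i)).
  by rewrite mulrA ler_wpM2r // expr2 ler_wpM2r // ltW.
exact: arith sum_le A_le B_le E_le D_le su0 s2u.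
Qed.

End Small.

(** Any embedding built from an orthonormal family is at distance at most two
    from [phi]. *)
Lemma embedding_le2 (b : 'I_n -> H) :
  (forall i j, hdot (b i) (b j) = (i == j)%:R) ->
  forall k (a : 'I_k -> 'I_k -> 'M[C]_n) (h : 'I_k -> H),
    (forall v, \sum_l NC (\sum_j a l j *m v j) <= \sum_i NC (v i)) ->
    \sum_i NH (\sum_j (embed b phi (a i j) (h j) - phi (a i j) (h j)))
      <= 4 * \sum_i NH (h i).
Proof.
move=> bb k a h a1.
have a1' v : \sum_l NC (\sum_j a l j *m v j) <= 1 ^+ 2 * \sum_i NC (v i).
  by rewrite expr1n mul1r; exact: a1.
have phi_le (h' : 'I_k -> H) :
    \sum_i NH (\sum_j phi (a i j) (h' j)) <= \sum_i NH (h' i).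
  by have := cp_contractive phi_cp phi1 h' a1'; rewrite expr1n mul1r.
have psi_le : \sum_i NH (\sum_j embed b phi (a i j) (h j)) <= \sum_i NH (h i).
  under eq_bigr => i _ do rewrite nsq_embed //.
  rewrite big_split /=.
  have -> : \sum_i NH (h i) =
      \sum_i NC (coiso b (h i)) + \sum_i NH (perp b (h i)).
    by rewrite -big_split; apply: eq_bigr => i _; exact: nsq_split.
  rewrite lerD //; apply: le_trans (phi_le _); apply: ler_sum => i _.
  by rewrite [leRHS](nsq_split bb) lerDr nsq_ge0.
apply: le_trans (_ : 2 * \sum_i NH (\sum_j embed b phi (a i j) (h j)) +
    2 * \sum_i NH (\sum_j phi (a i j) (h j)) <= _); last first.
  by have := phi_le h; lra.
rewrite !mulr_sumr -big_split; apply: ler_sum => i _ /=.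
by rewrite sumrB nsqB_le.
Qed.

End Main.

(** Numerical bounds in the regime of small [delta], where [a] is a power of it
    and [K] one of the two large constants. *)
Lemma small_power (R : realFieldType) (K a : R) m :
  0 < a -> 8 <= K -> K * a < 2 -> (4 <= m)%N ->
  a ^+ m <= 100^-1 /\ 36 * a ^+ m <= (K * a) ^+ 2.
Proof.
move=> a0 K8 Ka m4.
have Ka8 : 8 * a <= K * a by rewrite ler_wpM2r // ltW.
have a4 : a <= 4^-1 by lra.
have am : a ^+ m <= a ^+ 4 by rewrite ler_wiXn2l ?(ltW a0) //; lra.
have sq : a ^+ 2 <= 4^-1 ^+ 2 by rewrite ler_sqr ?nnegrE ?(ltW a0).
have sq0 : 0 <= a ^+ 2 by rewrite sqr_ge0.
have a4E : a ^+ 4 <= 16^-1 * a ^+ 2.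
  have -> : a ^+ 4 = a ^+ 2 * a ^+ 2 by rewrite -exprD.
  by rewrite ler_wpM2r //; lra.
have : (8 * a) ^+ 2 <= (K * a) ^+ 2.
  by rewrite ler_sqr ?nnegrE ?mulr_ge0 ?(ltW a0) //; lra.
by rewrite [(8 * a) ^+ 2]exprMn => h; split; lra.
Qed.

Theorem theorem2p27 (R : realType) (n : nat) (n_gt0 : (0 < n)%N)
    (H : hilbertType R) (delta : R) (delta_gt0 : 0 < delta)
    (phi : {linear 'M[R[i]]_n -> 'B(H)})
    (phi_inj : injective phi)
    (phi_cp : completely_positive phi)
    (phi_contr : contractive phi)
    (phi_inv : (cb_norm (range phi) ('pinv_(fun=> 0%R) setT phi)
                < (1 + delta)%R%:E)%E)
    (p : 'B(H)) (p_rank1 : rank1_projection p)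
    (x : 'M[R[i]]_n) (phi_x : (os_norm (phi x - p)%R < delta%:E)%E) :
  (exists r : 'M[R[i]]_n, rank1_projection_mx r /\
     (os_norm (phi r - p)%R <= (315 * delta `^ (1 / 8))%R%:E)%E) /\
  (exists psi : {linear 'M[R[i]]_n -> 'B(H)}, complete_order_embedding psi /\
     (cb_norm setT (psi \- phi)%R <= (1360 * delta `^ (1 / 32))%R%:E)%E).
Proof.
have phi1 := contractive_le1 phi_contr.
have [e [e1 pE]] := rank1_projectionP p_rank1.
(* [t] is the 32nd root of [delta], and [s] its square root *)
pose t := delta `^ (1 / 32).
have t0 : 0 < t by exact: powR_gt0.
have t32 : t ^+ 32 = delta.
  by rewrite -powR_mulrn ?(ltW t0) // -powRrM mul1r mulVf // powRr1 // ltW.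
have t4 : delta `^ (1 / 8) = t ^+ 4.
  rewrite -powR_mulrn ?(ltW t0) // -powRrM; congr (_ `^ _); lra.
rewrite t4 -/t; pose s := t ^+ 16.
have s0 : 0 < s by rewrite exprn_gt0.
have s2 : s ^+ 2 = delta by rewrite -exprM.
have inv := inverse_bound phi_inj (addr_ge0 ler01 (ltW delta_gt0)) (ltW phi_inv).
have phi_xh h : nsq (@hdot R H) (phi x h - hdot h e *: e) <= delta ^+ 2 * nsq (@hdot R H) h.
  by have /(bop_normP _ (ltW delta_gt0))/(_ h) := ltW phi_x; rewrite bopB pE.
rewrite -s2 in inv phi_xh.
have K1 : 8 <= 315 :> R by rewrite ler_nat.
have K2 : 8 <= 1360 :> R by rewrite ler_nat.
move: K1 K2; move: (315 : R) (1360 : R) => K1 K2 K1_ge K2_ge.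
have K1_0 : 0 <= K1 by lra.
have K2_0 : 0 <= K2 by lra.
have two_sq (b : R) : 2 <= b -> 4 <= b ^+ 2 by move=> b2; rewrite expr2; nra.
split.
- pose a := t ^+ 4; have a0 : 0 < a by rewrite exprn_gt0.
  have sE : s = a ^+ 4 by rewrite -exprM.
  rewrite -/a; have M0 : 0 <= K1 * a by rewrite mulr_ge0 // ltW.
  have [big|small] := lerP 2 (K1 * a).
    pose f : 'cV[R[i]]_n := delta_mx (Ordinal n_gt0) 0.
    have f1 : nsq (@cdot R n) f = 1 by rewrite /nsq /rdot /= cdot_delta mxE !eqxx.
    exists (outer f f); split; first exact: rank1_outer.
    apply/bop_normP => // h; rewrite bopB.
    have K4 := two_sq _ big.
    apply: le_trans (nsqB_le _ _ _) (le_trans _ (ler_wpM2r (nsq_ge0 _ h) K4)).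
    have : nsq (@hdot R H) (phi (outer f f) h) <= 1 ^+ 2 * nsq (@hdot R H) h.
      apply: cp_contractive1 => // u; rewrite outer_mulmx nsqZ f1 mulr1.
      by rewrite expr1n mul1r csq_dot_unit.
    have : nsq (@hdot R H) (p h) <= nsq (@hdot R H) h.
      by rewrite pE nsqZ e1 mulr1 csq_dot_unit.
    by rewrite expr1n mul1r; lra.
  have [s_small s_le] := small_power a0 K1_ge small (leqnn 4).
  rewrite -sE in s_small s_le.
  have [r [r1 rp]] := close_projection phi_cp phi1 s0 s_small inv e1 pE phi_xh.
  exists r; split=> //; apply/bop_normP => // h; apply: le_trans (rp h) _.
  by rewrite ler_wpM2r ?nsq_ge0 //; lra.
have M0 : 0 <= K2 * t by rewrite mulr_ge0 // ltW.
have [big|small] := lerP 2 (K2 * t).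
  have [b bb] := orthonormal_exists phi_inj (leqnn n).
  exists (embed b phi); split; first exact: embed_order_embedding.
  apply: (@cb_norm_sub_le _ _ _ _ _ 4) => //; last exact: embedding_le2.
  exact: two_sq big.
have [s_small s_le] := small_power (m := 16) t0 K2_ge small isT.
have [b [bb b_le]] := close_embedding phi_cp phi1 s0 s_small inv e1 pE phi_xh.
exists (embed b phi); split; first exact: embed_order_embedding.
exact: cb_norm_sub_le b_le.
Qed.
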